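(* Let $r\ge 2$, let $\nu$ be a partition with $|\nu|\le r$, let $1\le k\le r-1$ and let $\mathsf t\in\mathrm{Std}_r(\nu)$. If $\mathsf t_{k\leftrightarrow k+1}$ exists, then in the partition algebra $P_r(n)$ $$u_{\mathsf t}\,s_{k,k+1}=u_{\mathsf t_{k\leftrightarrow k+1}}+u_{\mathsf e_k(\mathsf t)}-u_{\mathsf e_k(\mathsf t_{k\leftrightarrow k+1})},$$ where $u_{\mathsf e_k(\mathsf v)}$ is interpreted as $0$ whenever $\mathsf e_k(\mathsf v)$ is undefined.
   Context: Partitions: $|\lambda|$ is the size, $\ell(\lambda)$ the number of nonzero parts, $[\lambda]_a=\lambda_1+\dots+\lambda_a$, $[\lambda]_0=0$. For $i\ge1$, $\pm\varepsilon_i$ means adding/removing a box in row $i$, and $\varepsilon_0=0$. Paths. $\mathrm{Std}_r(\nu)$ is the set of sequences $\mathsf t=(-\varepsilon_{i_1},+\varepsilon_{j_1},\dots,-\varepsilon_{i_r},+\varepsilon_{j_r})$, $i_k,j_k\in\mathbb Z_{\ge0}$, such that with $\mathsf t(0)=\varnothing$, $\mathsf t(k-\frac12)=\mathsf t(k-1)-\varepsilon_{i_k}$, $\mathsf t(k)=\mathsf t(k-\frac12)+\varepsilon_{j_k}$, all $\mathsf t(k),\mathsf t(k-\frac12)$ are partitions and $\mathsf t(r)=\nu$ (paths in the branching graph of the partition algebras). The pair $(-\varepsilon_{i_k},+\varepsilon_{j_k})$ is the $k$-th integral step. $\mathsf t_{k\leftrightarrow k+1}$ is the sequence obtained by interchanging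 the $k$-th and $(k+1)$-th integral steps; it exists if it lies in $\mathrm{Std}_r(\nu)$. If $j_k=i_{k+1}=u\ge1$ (i.e. $\mathsf t(k-\frac12)\xrightarrow{+\varepsilon_u}\mathsf t(k)\xrightarrow{-\varepsilon_u}\mathsf t(k+\frac12)$), then $\mathsf e_k(\mathsf t)\in\mathrm{Std}_r(\nu)$ is the path agreeing with $\mathsf t$ except that $\mathsf e_k(\mathsf t)(k)=\mathsf t(k-\frac12)+\varepsilon_L$ with $L=\ell(\mathsf t(k-\frac12))+1$ (i.e. $j_k$ and $i_{k+1}$ are replaced by $L$); otherwise $\mathsf e_k(\mathsf t)$ is undefined. Partition algebra. $P_r(n)$ (over $\mathbb Q$, $n$ an integer) has basis the set partitions of $\{1,\dots,r,\bar1,\dots,\bar r\}$, drawn as diagrams with northern vertices $\bar1,\dots,\bar r$ and southern vertices $1,\dots,r$; $xy$ is obtained by placing $x$ above $y$, identifying southern vertices of $x$ with northern vertices of $y$, deleting the $t$ components consisting only of middle vertices and multiplying by $n^t$. $s_{k,k+1}$ is the diagram with blocks $\{\bar k,k+1\},\{\overline{k+1},k\}$ and $\{\bar i,i\}$ otherwise; $p_k$ has blocks $\{\bar k\},\{k\}$ and $\{\bar i,i\}$ otherwise; $p_{k+\frac12}$ has block $\{k,k+1,\bar k,\overline{k+1}\}$ and $\{\bar i,i\}$ otherwise. Let $e^{(l)}_k=p_{k-l+1}\cdots p_k$, $e^{(l)}_{k+\frac12}=p_{k-l+\frac32}\cdots p_{k+\frac12}$ ($l$ factors), with $e^{(l)}_k=e^{(l)}_{k-\frac12}=1$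 if $k=0$ or $l=0$. For $1\le l\le k$, $s_{l,k}=s_{l,l+1}s_{l+1,l+2}\cdots s_{k-1,k}$; for $k<l$, $s_{l,k}=s_{k,l}^{-1}$; $s_{l,k}=1$ if $l=0$ or $k=0$. For a partition $\gamma$ and $b\ge1$ let $M_{\gamma,b}=\sum_{i=0}^{\gamma_b-1}s_{[\gamma]_b-i,[\gamma]_b}$, and $M_{\gamma,0}=1$. For $\mathsf t\in\mathrm{Std}_r(\nu)$ and $0\le k<r$ with $\mathsf t(k)=\alpha\xrightarrow{-\varepsilon_a}\mathsf t(k+\frac12)=\beta\xrightarrow{+\varepsilon_b}\mathsf t(k+1)=\gamma$, put $u_{\mathsf t(k)\to\mathsf t(k+\frac12)}=e^{(k-|\beta|)}_{k+\frac12}s_{|\alpha|,[\alpha]_a}$ and $u_{\mathsf t(k+\frac12)\to\mathsf t(k+1)}=e^{(k+1-|\gamma|)}_{k+1}M_{\gamma,b}\,s_{[\gamma]_b,|\gamma|}$, and $u_{\mathsf t}=u_{\mathsf t(r-\frac12)\to\mathsf t(r)}\cdots u_{\mathsf t(\frac12)\to\mathsf t(1)}u_{\mathsf t(0)\to\mathsf t(\frac12)}$. *)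

(* Defs.v *)
From HB Require Import structures.
From mathcomp Require Import all_boot all_order all_algebra.
Set Implicit Arguments.
Unset Strict Implicit.
Unset Printing Implicit Defensive.
Import Order.TTheory GRing.Theory Num.Theory.

Definition is_part (la : seq nat) : bool := sorted geq la && all (fun x => 0 < x) la.

Definition psize (la : seq nat) : nat := sumn la.
Definition plen (la : seq nat) : nat := size la.
(* la_i, rows indexed from 1 *)
Definition prow (la : seq nat) (i : nat) : nat := nth 0 la i.-1.
Definition ppref (la : seq nat) (a : nat) : nat := sumn (take a la).

Definition strip0 (s : seq nat) : seq nat :=
  rev (drop (find (fun x => x != 0) (rev s)) (rev s)).

Definition rmbox (la : seq nat) (i : nat) : seq nat :=
  if i == 0 then la else strip0 (set_nth 0 la i.-1 (prow la i).-1).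
(* la - eps_i is a partition (for i >= 1 this needs la_i >= 1) *)
Definition rm_ok (la : seq nat) (i : nat) : bool :=
  (i == 0) || ((0 < prow la i) && is_part (rmbox la i)).

Definition addbox (la : seq nat) (j : nat) : seq nat :=
  if j == 0 then la else incr_nth la j.-1.

(* Paths.  A path t = (-eps_{i_1},+eps_{j_1},...,-eps_{i_r},+eps_{j_r}) *)
(* is the list [:: (i_1,j_1); ...; (i_r,j_r)] of its integral steps.   *)

Definition step := (nat * nat)%type.
Definition pathT := seq step.

Definition nstep (t : pathT) (k : nat) : step := nth (0, 0) t k.

Definition pst (t : pathT) (m : nat) : seq nat :=
  foldl (fun la p => addbox (rmbox la p.1) p.2) [::] (take m t).
Definition phalf (t : pathT) (m : nat) : seq nat :=
  rmbox (pst t m) (nstep t m).1.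

Definition Std (r : nat) (nu : seq nat) (t : pathT) : bool :=
  [&& size t == r,
      all (fun m => rm_ok (pst t m) (nstep t m).1 &&
                    is_part (addbox (phalf t m) (nstep t m).2)) (iota 0 r)
    & pst t r == nu].

(* t_{k <-> k+1}: interchange the k-th and (k+1)-th integral steps (1-indexed) *)
Definition pswap (t : pathT) (k : nat) : pathT :=
  set_nth (0, 0) (set_nth (0, 0) t k.-1 (nstep t k)) k (nstep t k.-1).

Definition ek_def (t : pathT) (k : nat) : bool :=
  ((nstep t k.-1).2 == (nstep t k).1) && (1 <= (nstep t k).1).

Definition ek (t : pathT) (k : nat) : pathT :=
  let L := (plen (phalf t k.-1)).+1 in
  set_nth (0, 0) (set_nth (0, 0) t k.-1 ((nstep t k.-1).1, L)) k
          (L, (nstep t k).2).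

(* Vertices: (true, i) is the northern vertex \bar{i+1},               *)
(*           (false, i) is the southern vertex i+1   (i : 'I_r).       *)
(* A diagram is a set partition of the vertices: {set {set V r}}.      *)
(* Elements of the algebra are Q-valued functions on diagrams          *)
(* (coefficients w.r.t. the diagram basis).                            *)

Notation V r := (bool * 'I_r)%type.
Notation diagram r := {set {set V r}}.
Notation PA r := {ffun diagram r -> rat}.

(* three layers used for concatenation *)
Definition L0 : 'I_3 := @Ordinal 3 0 isT.
Definition L1 : 'I_3 := @Ordinal 3 1 isT.
Definition L2 : 'I_3 := @Ordinal 3 2 isT.
Notation W r := ('I_3 * 'I_r)%type.

(* x placed above y: north of x -> top layer, south of x -> middle layer *)
Definition embTop r (v : V r) : W r := if v.1 then (L0, v.2) else (L1, v.2).
(* north of y -> middle layer, south of y -> bottom layer *)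
Definition embBot r (v : V r) : W r := if v.1 then (L1, v.2) else (L2, v.2).
Definition embOut r (v : V r) : W r := if v.1 then (L0, v.2) else (L2, v.2).

Definition catedge r (d1 d2 : diagram r) : rel (W r) := fun w w' =>
  [exists B in d1, (w \in @embTop r @: B) && (w' \in @embTop r @: B)] ||
  [exists B in d2, (w \in @embBot r @: B) && (w' \in @embBot r @: B)].

Definition catconn r (d1 d2 : diagram r) : rel (W r) := connect (catedge d1 d2).

(* the diagram d1 d2 (without the power of n) *)
Definition dcomp r (d1 d2 : diagram r) : diagram r :=
  equivalence_partition (fun v w => catconn d1 d2 (@embOut r v) (@embOut r w)) [set: V r].

Definition dmid r (d1 d2 : diagram r) : nat :=
  #|[set C in equivalence_partition (catconn d1 d2) [set: W r]
     | C \subset [set w : W r | w.1 == L1]]|.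

Definition pbasis r (d : diagram r) : PA r := [ffun d' => ((d' == d)%:R)%R].

Definition pmul r (n : int) (x y : PA r) : PA r :=
  [ffun d => (\sum_(d1 : diagram r) \sum_(d2 : diagram r)
     x d1 * y d2 * (n%:~R) ^+ (dmid d1 d2) * pbasis (dcomp d1 d2) d)%R].

(* diagram given by a (reflexive, symmetric) relation, vertex labels 1..r *)
Definition vlab r (v : V r) : nat := (nat_of_ord v.2).+1.
Definition mkdiag r (R : rel (V r)) : diagram r := equivalence_partition R [set: V r].

Definition pone r : PA r := pbasis (mkdiag (fun v w : V r => vlab v == vlab w)).

Definition swapl (k x : nat) : nat := if x == k then k.+1 else if x == k.+1 then k else x.

(* s_{k,k+1}: blocks {\bar k, k+1}, {\bar{k+1}, k}, {\bar i, i} otherwise *)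
Definition sgen r (k : nat) : PA r :=
  pbasis (mkdiag (fun v w : V r => (v == w) || ((v.1 != w.1) && (swapl k (vlab v) == vlab w)))).

(* p_k: blocks {\bar k}, {k}, {\bar i, i} otherwise *)
Definition pgen r (k : nat) : PA r :=
  pbasis (mkdiag (fun v w : V r => (v == w) || ((vlab v == vlab w) && (vlab v != k)))).

(* p_{k+1/2}: block {k, k+1, \bar k, \bar{k+1}}, {\bar i, i} otherwise *)
Definition phgen r (k : nat) : PA r :=
  pbasis (mkdiag (fun v w : V r => (vlab v == vlab w) ||
                     ((vlab v \in [:: k; k.+1]) && (vlab w \in [:: k; k.+1])))).

Definition pprod r (n : int) (xs : seq (PA r)) : PA r := foldr (pmul n) (pone r) xs.

Definition eint r (n : int) (l k : nat) : PA r :=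
  if (k == 0) || (l == 0) then pone r
  else pprod n [seq pgen r j | j <- iota (k - l).+1 l].

(* e^{(l)}_{k+1/2} = p_{k-l+3/2} ... p_{k+1/2} *)
Definition ehalf r (n : int) (l k : nat) : PA r :=
  if l == 0 then pone r
  else pprod n [seq phgen r j | j <- iota (k - l).+1 l].

Definition sLK r (n : int) (l k : nat) : PA r :=
  if (l == 0) || (k == 0) then pone r
  else if l <= k then pprod n [seq sgen r j | j <- iota l (k - l)]
  (* k < l : s_{l,k} = s_{k,l}^{-1} = s_{l-1,l} ... s_{k,k+1} *)
  else pprod n [seq sgen r j | j <- rev (iota k (l - k))].

Definition Mgb r (n : int) (ga : seq nat) (b : nat) : PA r :=
  if b == 0 then pone r
  else (\sum_(0 <= i < prow ga b) sLK r n (ppref ga b - i) (ppref ga b))%R.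

Definition uA r (n : int) (t : pathT) (m : nat) : PA r :=
  let al := pst t m in let be := phalf t m in let a := (nstep t m).1 in
  pmul n (ehalf r n (m - psize be) m) (sLK r n (psize al) (ppref al a)).

Definition uB r (n : int) (t : pathT) (m : nat) : PA r :=
  let ga := pst t m.+1 in let b := (nstep t m).2 in
  pmul n (eint r n (m.+1 - psize ga) m.+1)
         (pmul n (Mgb r n ga b) (sLK r n (ppref ga b) (psize ga))).

Definition u_path r (n : int) (t : pathT) : PA r :=
  pprod n (flatten [seq [:: uB r n t m; uA r n t m] | m <- rev (iota 0 (size t))]).

Definition u_ek r (n : int) (t : pathT) (k : nat) : PA r :=
  if ek_def t k then u_path r n (ek t k) else 0%R.

(* Main.v *)
Require Import Defs.
From mathcomp Require Import all_boot all_order all_algebra zify.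
Import GRing.Theory.
Local Open Scope ring_scope.
Set Implicit Arguments.
Unset Strict Implicit.
Unset Printing Implicit Defensive.

(**
Read from right to left, [u_t] builds its diagrams one southern vertex at a
time, and no closed loop ever appears.  The step [(-eps_a, +eps_b)] number [m]
takes the block at the end of row [a] of a tableau of propagating blocks (a new
block if [a = 0]), adds the southern vertex [m] to it and inserts it in row [b]
at all possible places (the block stops propagating if [b = 0]).  Hence [u_t]
is the sum, without multiplicities, of the diagrams attached to the pairs
[(g, w)], where [g] lists the blocks moved by the successive steps, each of them
being in the row prescribed by [t], and [w] is any row-sorted word in the
blocks that propagate at the end.

Right multiplication by [s_{k,k+1}] exchanges the southern vertices [k] and
[k+1].  If the steps [k] and [k+1] move different blocks, they commute, and one
gets the same kind of terms of the path with the two steps interchanged.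
If they move the same block, the diagram is fixed; these terms form [u_{e_k(t)}],
because in [e_k(t)] the block moved at step [k] is alone in its row and has to be
moved again at step [k+1].
*)

(** * Products of labelled diagrams *)

Section Bilinear.
Variables (r : nat) (n : int).
Implicit Types x y : PA r.

Lemma pmul_sumr (I : Type) (s : seq I) (F : I -> PA r) x :
  pmul n x (\sum_(i <- s) F i) = \sum_(i <- s) pmul n x (F i).
Proof.
apply/ffunP => d; rewrite sum_ffunE ffunE.
under [RHS]eq_bigr do rewrite ffunE.
rewrite [RHS]exchange_big /=; apply: eq_bigr => d1 _.
rewrite [RHS]exchange_big /=; apply: eq_bigr => d2 _.
by rewrite sum_ffunE mulr_sumr !mulr_suml.
Qed.

Lemma pmul_suml (I : Type) (s : seq I) (F : I -> PA r) y :
  pmul n (\sum_(i <- s) F i) y = \sum_(i <- s) pmul n (F i) y.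
Proof.
apply/ffunP => d; rewrite sum_ffunE ffunE.
under [RHS]eq_bigr do rewrite ffunE.
rewrite [RHS]exchange_big /=; apply: eq_bigr => d1 _.
rewrite [RHS]exchange_big /=; apply: eq_bigr => d2 _.
by rewrite sum_ffunE !mulr_suml.
Qed.

Lemma pmul_basis (d1 d2 : diagram r) : dmid d1 d2 = 0%N ->
  pmul n (pbasis d1) (pbasis d2) = pbasis (dcomp d1 d2).
Proof.
move=> d0; apply/ffunP => d; rewrite ffunE (bigD1 d1) //= [X in _ + X]big1 ?addr0.
  rewrite (bigD1 d2) //= [X in _ + X]big1 ?addr0 ?ffunE ?eqxx ?d0 ?expr0 ?mul1r //.
  by move=> e /negPf ne; rewrite !ffunE ne mulr0 !mul0r.
move=> e /negPf ne; rewrite big1 // => e' _.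
by rewrite !ffunE ne !mul0r.
Qed.

End Bilinear.

Lemma mkdiag_ext r (R R' : rel (V r)) : R =2 R' -> mkdiag R = mkdiag R'.
Proof.
move=> e; rewrite /mkdiag /equivalence_partition; apply: eq_imset => x.
by apply/setP => y; rewrite !inE e.
Qed.

(** Diagrams are encoded as the fibres of a labelling of the vertices. Only equality of labels
    matters, so an injective renaming leaves the diagram unchanged, and numbers from [r] on can
    serve as fresh labels. *)
Definition lab r (f g : nat -> nat) (v : V r) : nat :=
  if v.1 then f v.2 else g v.2.
Definition ldiag r (f g : nat -> nat) : diagram r :=
  mkdiag (fun v w : V r => lab f g v == lab f g w).
Definition lbasis r f g : PA r := pbasis (ldiag r f g).

Lemma lbasis_inj r (f g f' g' : nat -> nat) (e : nat -> nat) :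
  injective e ->
  (forall i, (i < r)%N -> f' i = e (f i)) ->
  (forall i, (i < r)%N -> g' i = e (g i)) ->
  lbasis r f' g' = lbasis r f g.
Proof.
move=> ei ef eg; congr pbasis; apply: mkdiag_ext => -[b i] [c j].
have E (w : V r) : lab f' g' w = e (lab f g w).
  by case: w => -[] k; rewrite /lab /= ?ef ?eg.
by rewrite !E (inj_eq ei).
Qed.

Lemma lbasis_ext r (f g f' g' : nat -> nat) :
  (forall i, (i < r)%N -> f' i = f i) ->
  (forall i, (i < r)%N -> g' i = g i) ->
  lbasis r f' g' = lbasis r f g.
Proof. exact: (@lbasis_inj _ _ _ _ _ id). Qed.

Lemma in_ldiagP r (T : finType) (c : V r -> nat) (emb : V r -> T) (w w' : T) :
  reflect (exists v v', [/\ w = emb v, w' = emb v' & c v = c v'])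
   [exists B in mkdiag (fun v w : V r => c v == c w),
      (w \in emb @: B) && (w' \in emb @: B)].
Proof.
apply: (iffP exists_inP) => [[B /imsetP[x _ ->]]|[v [v' [-> -> e]]]].
  case/andP=> /imsetP[v + ->] /imsetP[v' + ->].
  by rewrite !inE /= => /eqP ev /eqP ev'; exists v, v'; rewrite -ev.
exists [set y in [set: V r] | c v == c y]; first by apply/imsetP; exists v.
by apply/andP; split; apply/imsetP; [exists v|exists v']; rewrite ?inE ?e /=.
Qed.

Lemma catconn_sym r (d1 d2 : diagram r) : connect_sym (catedge d1 d2).
Proof.
apply: sym_connect_sym => x y; rewrite /catedge.
by congr orb; apply: eq_existsb => B; rewrite [(x \in _) && _]andbC.
Qed.

Section Compose.
Variables (r : nat) (n : int) (f1 g1 f2 g2 : nat -> nat) (h : W r -> nat).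
Let d1 := ldiag r f1 g1.
Let d2 := ldiag r f2 g2.

Lemma catedge_top (v v' : V r) : lab f1 g1 v = lab f1 g1 v' ->
  catedge d1 d2 (embTop v) (embTop v').
Proof. by move=> e; apply/orP; left; apply/in_ldiagP; exists v, v'. Qed.

Lemma catedge_bot (v v' : V r) : lab f2 g2 v = lab f2 g2 v' ->
  catedge d1 d2 (embBot v) (embBot v').
Proof. by move=> e; apply/orP; right; apply/in_ldiagP; exists v, v'. Qed.

Hypothesis h_top : forall v v' : V r,
  lab f1 g1 v = lab f1 g1 v' -> h (embTop v) = h (embTop v').
Hypothesis h_bot : forall v v' : V r,
  lab f2 g2 v = lab f2 g2 v' -> h (embBot v) = h (embBot v').
Hypothesis h_conn : forall w w', h w = h w' -> catconn d1 d2 w w'.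
Hypothesis h_mid : forall i, exists2 w, h (L1, i) = h w & w.1 != L1.

Lemma catconnE w w' : catconn d1 d2 w w' = (h w == h w').
Proof.
apply/idP/eqP => [/connectP[p]|]; last exact: h_conn.
elim: p w => [|x p IH] w /= => [_ -> //|/andP[e pp] l].
rewrite -(IH _ pp l); case/orP: e => /in_ldiagP[v [v' [-> -> e]]].
  exact: h_top.
exact: h_bot.
Qed.

(** The hypotheses make the fibres of [h] exactly the connected components of the three layers, so
    [h] restricted to the outer layers labels the product. By [h_mid] every component reaches an
    outer layer: no loop is removed and the power of [n] is 1. *)
Lemma lbasis_mul_gen (f g : nat -> nat) :
  (forall v : V r, lab f g v = h (embOut v)) ->
  pmul n (lbasis r f1 g1) (lbasis r f2 g2) = lbasis r f g.
Proof.
move=> hf; rewrite /lbasis pmul_basis.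
  by congr pbasis; apply: mkdiag_ext => v w; rewrite catconnE !hf.
apply/eqP; rewrite cards_eq0; apply/set0Pn => -[C].
rewrite inE => /andP[/imsetP[x _ ->] /subsetP sC].
have xC: x \in [set y in [set: W r] | catconn d1 d2 x y].
  by rewrite !inE /= /catconn connect0.
have := sC _ xC; rewrite inE => /eqP x1.
have [w hw] := h_mid x.2.
have: w \in [set y in [set: W r] | catconn d1 d2 x y].
  by rewrite !inE /= catconnE -hw -x1 -surjective_pairing.
by move=> /sC; rewrite inE => ->.
Qed.

End Compose.

(* The left factor isolates the northern vertices satisfying [K], joins every
   other northern vertex [i] to the southern vertex [p i], and merges the
   southern vertices satisfying [J] (represented by [j0]).  The isolated
   vertices get the labels [r + i], and [mu] identifies the labels that the
   northern vertices of the right factor satisfying [J] carry. *)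
Section LeftMul.
Variables (r : nat) (n : int) (K J : pred nat) (j0 : nat).
Variables (p f2 g2 mu : nat -> nat).
Let psi j := if J j then j0 else j.
Let top i := if K i then (r + i)%N else psi (p i).
Let res i := if K i then (r + i)%N else mu (f2 (p i)).

Hypothesis p_lt : forall i, (i < r)%N -> ~~ K i -> (p i < r)%N.
Hypothesis J0 : forall j, (j < r)%N -> J j -> J j0 && (j0 < r)%N.
Hypothesis mu_J : forall j, (j < r)%N -> J j -> mu (f2 j) = mu (f2 j0).
Hypothesis mu_inj : forall x y, mu x = mu y -> x = y \/
  (exists j j', [/\ (j < r)%N, (j' < r)%N, J j, J j' & x = f2 j /\ y = f2 j']).
Hypothesis fresh : forall i j, (i < r)%N -> (j < r)%N -> K i ->
  (mu (f2 j) != r + i)%N /\ (mu (g2 j) != r + i)%N.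
Hypothesis noloop : forall j, (j < r)%N ->
  (exists i, [/\ (i < r)%N, ~~ K i & psi (p i) = psi j]) \/
  (exists2 i, (i < r)%N & f2 j = g2 i).

Let psi_lt j : (j < r)%N -> (psi j < r)%N.
Proof. by move=> lj; rewrite /psi; case: ifP => // /(J0 lj)/andP[]. Qed.

Let mu_psi j : (j < r)%N -> mu (f2 (psi j)) = mu (f2 j).
Proof. by move=> lj; rewrite /psi; case: ifP => // /(mu_J lj). Qed.

Let h (w : W r) : nat :=
  if w.1 == L0 then res w.2 else if w.1 == L1 then mu (f2 w.2) else mu (g2 w.2).

Let hT (v : V r) : h (embTop v) = if v.1 then res v.2 else mu (f2 v.2).
Proof. by case: v => -[]. Qed.
Let hB (v : V r) : h (embBot v) = mu (lab f2 g2 v).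
Proof. by case: v => -[]. Qed.

Local Notation conn := (catconn (ldiag r top psi) (ldiag r f2 g2)).

Let conn_top (v v' : V r) : lab top psi v = lab top psi v' ->
  conn (embTop v) (embTop v').
Proof. by move=> e; apply/connect1/catedge_top. Qed.
Let conn_bot (v v' : V r) : lab f2 g2 v = lab f2 g2 v' ->
  conn (embBot v) (embBot v').
Proof. by move=> e; apply/connect1/catedge_bot. Qed.

Let mid_bot (i : 'I_r) : (L1, i) = embBot (true, i). Proof. by []. Qed.
Let mid_top (i : 'I_r) : (L1, i) = embTop (false, i). Proof. by []. Qed.

Let conn_BB (v v' : V r) : mu (lab f2 g2 v) = mu (lab f2 g2 v') ->
  conn (embBot v) (embBot v').
Proof.
move=> /mu_inj[/conn_bot //|[j [j' [lj lj' Jj Jj' [e e']]]]].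
apply: (@connect_trans _ _ (embBot (true, Ordinal lj))); first exact: conn_bot.
apply: (@connect_trans _ _ (embBot (true, Ordinal lj'))); last exact: conn_bot.
by rewrite -!mid_bot !mid_top; apply: conn_top; rewrite /lab /= /psi Jj Jj'.
Qed.

Let to_bot (w : W r) : (w.1 == L0) && K w.2 \/
  exists2 v, conn w (embBot v) & h w = mu (lab f2 g2 v).
Proof.
case: w => -[[|[|[|//]]] lt3] i.
- rewrite (bool_irrelevance lt3 isT) -/L0 /=; case Ki: (K i); [by left|right].
  have lp := p_lt (ltn_ord i) (negbT Ki).
  exists (true, Ordinal (psi_lt lp)).
    apply: (@conn_top (true, i) (false, Ordinal (psi_lt lp))).
    rewrite /lab /= /top Ki {2}/psi.
    case: ifP => //; rewrite /psi; case: ifP => [/(J0 lp)/andP[Jj _]|].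
      by rewrite Jj.
    by move=> ->.
  by rewrite /h /= /res Ki /lab /= mu_psi.
- rewrite (bool_irrelevance lt3 isT) -/L1; right.
  by exists (true, i); rewrite ?mid_bot ?hB // /catconn connect0.
- rewrite (bool_irrelevance lt3 isT) -/L2; right.
  by exists (false, i); rewrite // /catconn connect0.
Qed.

Let h_fresh (i : 'I_r) (v : V r) : K i -> h (L0, i) <> mu (lab f2 g2 v).
Proof.
move=> Ki; rewrite /h /= /res Ki => /esym/eqP.
case: v => -[] j; rewrite /lab /=;
by have [/negPf e1 /negPf e2] := fresh (ltn_ord i) (ltn_ord j) Ki; rewrite ?e1 ?e2.
Qed.

(** Every vertex except the isolated northern ones is connected to the right factor ([to_bot]). Two
    vertices there with the same [mu]-label are connected inside that factor or through the merged
    set [J] ([conn_BB]). By [fresh], the labels of the isolated vertices meet no other label. *)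
Lemma lbasis_mul_left :
  pmul n (lbasis r top psi) (lbasis r f2 g2) = lbasis r res (mu \o g2).
Proof.
apply: (@lbasis_mul_gen _ _ _ _ _ _ h); last first.
- by move=> [[] i].
- move=> i; case: (noloop (ltn_ord i)) => [[i' [li nK e]]|[i' li e]].
    exists (L0, Ordinal li) => //.
    rewrite /h /= /res (negPf nK) -(mu_psi (p_lt li nK)) e mu_psi //.
  by exists (L2, Ordinal li) => //; rewrite /h /= e.
- move=> w w'; case: (to_bot w) => [/andP[/eqP w0 Kw]|[v cv ->]].
    case: (to_bot w') => [/andP[/eqP w0' Kw']|[v' cv' ->]]; last first.
      by case: w w0 Kw => w1 w2 /= -> Kw /(h_fresh Kw).
    rewrite /h w0 w0' /= /res Kw Kw' => /addnI/val_inj e.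
    rewrite (surjective_pairing w) (surjective_pairing w') w0 w0' e.
    exact: connect0.
  case: (to_bot w') => [/andP[/eqP w0' Kw']|[v' cv' ->]].
    by case: w' w0' Kw' => w1 w2 /= -> Kw /esym/(h_fresh Kw).
  move=> /conn_BB c; apply: connect_trans cv (connect_trans c _).
  by rewrite catconn_sym.
- by move=> v v' e; rewrite !hB e.
have muE (v : V r) : h (embTop v) =
    if v.1 && K v.2 then lab top psi v else mu (f2 (lab top psi v)).
  case: v => -[] i; rewrite hT /lab /=; last by rewrite mu_psi.
  by rewrite /res /top; case Ki: (K i) => //; rewrite mu_psi ?p_lt ?Ki.
move=> v v' e; rewrite !muE -e.
have P (u u' : V r) : lab top psi u = lab top psi u' ->
    u.1 && K u.2 -> u'.1 && K u'.2.
  case: u => -[] //= i; case: u' => -[] j + Ki; rewrite /lab /= {1}/top Ki.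
    rewrite /top; case: ifP => // Kj.
    by have := psi_lt (p_lt (ltn_ord j) (negbT Kj)); lia.
  by have := psi_lt (ltn_ord j); lia.
by rewrite (_ : v.1 && _ = v'.1 && K v'.2) //; apply/idP/idP; apply: P.
Qed.

End LeftMul.

(** Each vertex is connected to the left factor, because the bottom vertex [i] hangs below the
    middle vertex [p i]. With [p] an involution, one map describes these edges in both
    directions. *)
Lemma lbasis_mul_sgen r n f g (p : nat -> nat) :
  involutive p -> (forall i, (i < r)%N -> (p i < r)%N) ->
  pmul n (lbasis r f g) (lbasis r p id) = lbasis r f (g \o p).
Proof.
move=> pK p_lt.
pose h (w : W r) : nat :=
  if w.1 == L0 then f w.2 else if w.1 == L1 then g w.2 else g (p w.2).
pose d1 := ldiag r f g; pose d2 := ldiag r p id.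
have to_top w : exists2 v, catconn d1 d2 w (embTop v) & h w = lab f g v.
  case: w => -[[|[|[|//]]] lt3] i; rewrite (bool_irrelevance lt3 isT).
  - by exists (true, i); rewrite // /catconn connect0.
  - by exists (false, i); rewrite // /catconn connect0.
  exists (false, Ordinal (p_lt _ (ltn_ord i))) => //.
  apply/connect1/(@catedge_bot _ f g p id (false, i) (true, Ordinal _)).
  by rewrite /lab /= pK.
apply: (@lbasis_mul_gen _ _ _ _ _ _ h); last first.
- by move=> [[] i].
- move=> i; exists (L2, Ordinal (p_lt _ (ltn_ord i))) => //.
  by rewrite /h /= pK.
- move=> w w'; have [v cv ->] := to_top w; have [v' cv' ->] := to_top w'.
  move=> e; apply: connect_trans cv _; rewrite catconn_sym.
  by apply: connect_trans cv' _; apply/connect1/catedge_top.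
- move=> v v'; have E u : h (embBot u) = g (p (lab p id u)).
    by case: u => -[] i; rewrite /h /lab /= ?pK.
  by rewrite !E => ->.
move=> v v'; have E u : h (embTop u) = lab f g u by case: u => -[].
by rewrite !E.
Qed.

(** * The factors of [u_t] *)

(* Position [l] receives what is at position [k] (positions start at 0). *)
Definition cyc (l k i : nat) : nat :=
  if i == l then k else if (l < i <= k)%N then i.-1
  else if (k <= i < l)%N then i.+1 else i.

Lemma cycK l k : cancel (cyc k l) (cyc l k).
Proof. by move=> i; rewrite /cyc; do ?case: ifP; lia. Qed.

Lemma cyc_lt r l k i : (l < r)%N -> (k < r)%N -> (i < r)%N -> (cyc l k i < r)%N.
Proof. by rewrite /cyc; do ?case: ifP; lia. Qed.

Lemma cyc_id b i : cyc b b i = i.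
Proof. by rewrite /cyc; do ?case: ifP; lia. Qed.

Lemma cyc_comp l p k i : (l <= p <= k)%N -> cyc p k (cyc l p i) = cyc l k i.
Proof. by rewrite /cyc; do ?case: ifP; lia. Qed.

Lemma cyc_gt l k i : (l <= k < i)%N -> cyc l k i = i.
Proof. by rewrite /cyc; do ?case: ifP; lia. Qed.

Lemma cyc_le l k i : (l <= k)%N -> (i <= k)%N ->
  cyc l k i = if i == l then k else if (l < i)%N then i.-1 else i.
Proof. by rewrite /cyc; do ?case: ifP; lia. Qed.

Section Generators.
Variables (r : nat) (n : int).

Lemma pone_lbasis : pone r = lbasis r id id.
Proof.
by congr pbasis; apply: mkdiag_ext => -[[] i] [[] j]; rewrite /vlab /lab /= eqSS.
Qed.

Lemma sgen_lbasis k : sgen r k.+1 = lbasis r (cyc k k.+1) id.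
Proof.
congr pbasis; apply: mkdiag_ext => -[a [i li]] [b [j lj]].
rewrite xpair_eqE -val_eqE /vlab /lab /swapl.
by case: a b => -[] /=; rewrite /cyc; do ?case: ifP; lia.
Qed.

Lemma pgen_lbasis k :
  pgen r k.+1 = lbasis r (fun i => if i == k then (r + i)%N else i) id.
Proof.
congr pbasis; apply: mkdiag_ext => -[a [i li]] [b [j lj]].
rewrite xpair_eqE -val_eqE /vlab /lab.
by case: a b => -[] /=; do ?case: ifP; lia.
Qed.

Lemma phgen_lbasis k (psi := fun j => if (j == k) || (j == k.+1) then k else j) :
  phgen r k.+1 = lbasis r psi psi.
Proof.
congr pbasis; apply: mkdiag_ext => -[a [i li]] [b [j lj]].
rewrite /vlab /lab !inE /psi.
by case: a b => -[] /=; do ?case: ifP; lia.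
Qed.

Lemma lbasis_mul_perm (p f g : nat -> nat) :
  (forall i, (i < r)%N -> (p i < r)%N) ->
  (forall j, (j < r)%N -> exists2 i, (i < r)%N & p i = j) ->
  pmul n (lbasis r p id) (lbasis r f g) = lbasis r (f \o p) g.
Proof.
move=> p_lt p_surj.
apply: (@lbasis_mul_left r n (fun=> false) (fun=> false) 0%N p f g id) => //.
- by move=> i li _; apply: p_lt.
- by move=> x y; left.
- by move=> j /p_surj[i li e]; left; exists i.
Qed.

Lemma lbasis_mul_cyc l k f g : (l < r)%N -> (k < r)%N ->
  pmul n (lbasis r (cyc l k) id) (lbasis r f g) = lbasis r (f \o cyc l k) g.
Proof.
move=> ll lk; apply: lbasis_mul_perm => i li; first exact: cyc_lt.
by exists (cyc k l i); rewrite ?cycK // cyc_lt.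
Qed.

(** In both directions the leftmost generator is peeled off and absorbed into the cycle given by
    induction. *)
Lemma sLK_lbasis l k : (l < r)%N -> (k < r)%N ->
  sLK r n l.+1 k.+1 = lbasis r (cyc l k) id.
Proof.
move=> ll lk; rewrite /sLK /= ltnS; case: leqP => [le_lk|].
  rewrite subSS; move dE: (k - l)%N => d; elim: d l ll le_lk dE => [|d IH] l ll le dE.
    rewrite /= pone_lbasis; apply: lbasis_ext => i _ //; rewrite /cyc.
    by do ?case: ifP; lia.
  rewrite /= IH; try lia.
  rewrite sgen_lbasis lbasis_mul_cyc; try lia.
  by apply: lbasis_ext => // i _; rewrite /= /cyc; do ?case: ifP; lia.
elim: l ll => // l IH ll; rewrite ltnS => le_kl.
have ->: (l.+2 - k.+1 = (l - k) + 1)%N by lia.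
rewrite iotaD rev_cat map_cat /= addSn subnKC // sgen_lbasis.
case: (ltngtP k l) le_kl => // [lt_kl _|-> _].
  have ->: (l - k = l.+1 - k.+1)%N by lia.
  rewrite IH //; last lia.
  rewrite lbasis_mul_cyc //; last lia.
  by apply: lbasis_ext => // i _; rewrite /= /cyc; do ?case: ifP; lia.
rewrite subnn /= pone_lbasis lbasis_mul_cyc //; last lia.
by apply: lbasis_ext => // i _; rewrite /= /cyc; do ?case: ifP; lia.
Qed.

Lemma eint_lbasis l k : (l <= k)%N -> (k <= r)%N ->
  eint r n l k =
    lbasis r (fun i => if (k - l <= i < k)%N then (r + i)%N else i) id.
Proof.
move=> lk kr.
have E a : (a + l <= r)%N -> pprod n [seq pgen r j | j <- iota a.+1 l] =
    lbasis r (fun i => if (a <= i < a + l)%N then (r + i)%N else i) id.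
  elim: l {lk} a => [|l IH] a al.
    by rewrite /= pone_lbasis; apply: lbasis_ext => i _ //; case: ifP; lia.
  rewrite /= IH ?pgen_lbasis; last lia.
  rewrite (@lbasis_mul_left r n (pred1 a) (fun=> false) 0%N id _ id id) //=.
  - by apply: lbasis_ext => i _ //; do ?case: ifP; lia.
  - by move=> x y; left.
  - by move=> i j li lj /eqP ->; case: ifP; lia.
  move=> j lj; case: (eqVneq j a) => [->|ne]; last by left; exists j.
  by right; exists a; [lia|case: ifP; lia].
rewrite /eint; case: ifP => [/orP e|_]; last first.
  rewrite E; last lia.
  by apply: lbasis_ext => i _ //; do ?case: ifP; lia.
by rewrite pone_lbasis; apply: lbasis_ext => i _ //; case: ifP; lia.
Qed.

Lemma ehalf_lbasis b k (psi := fun j => if (b <= j <= k)%N then b else j) :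
  (b <= k)%N -> (k < r)%N -> ehalf r n (k - b) k = lbasis r psi psi.
Proof.
move=> bk kr.
have E l a (m := fun j => if (a <= j <= a + l)%N then a else j) : (a + l < r)%N ->
    pprod n [seq phgen r j | j <- iota a.+1 l] = lbasis r m m.
  elim: l a @m => [|l IH] a m al.
    by rewrite /= pone_lbasis; apply: lbasis_ext => i _; rewrite /m; case: ifP; lia.
  rewrite /= IH ?phgen_lbasis; last lia.
  rewrite (@lbasis_mul_left r n (fun=> false)
    (fun j => (j == a) || (j == a.+1)) a id _ _
    (fun x => if x == a.+1 then a else x)) //=.
  - by apply: lbasis_ext => i _ /=; rewrite /m; do ?case: ifP; lia.
  - lia.
  - by move=> j lj Jj; do ?case: ifP; lia.
  - move=> x y e; case: (eqVneq x y) => [|ne]; [by left|right].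
    have: (x = a /\ y = a.+1) \/ (x = a.+1 /\ y = a) by move: e; do ?case: ifP; lia.
    case=> -[-> ->]; [exists a, a.+1|exists a.+1, a];
      by split; rewrite ?eqxx ?orbT //; try lia; split; case: ifP; lia.
  - by move=> j lj; left; exists j.
rewrite /ehalf; case: ifP => [e|_].
  rewrite pone_lbasis.
  by apply: lbasis_ext => i _; rewrite /psi; case: ifP; lia.
rewrite E; last lia.
by apply: lbasis_ext => i _; rewrite /psi; do ?case: ifP; lia.
Qed.

(** The cycle joins the northern vertex [b] to the southern vertex [q], so the block merging [b..m]
    reaches the southern vertices [q] and [b+1..m]; it is named after [q], the position of the block
    to be moved. *)
Lemma ehalf_mul_cyc b q m
    (psi := fun j => if (j == q) || (b < j <= m)%N then q else j) :
  (q <= b <= m)%N -> (m < r)%N ->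
  pmul n (ehalf r n (m - b) m) (lbasis r (cyc b q) id) =
    lbasis r (psi \o cyc b q) psi.
Proof.
move=> /andP[qb bm] mr; rewrite ehalf_lbasis //.
rewrite (@lbasis_mul_left r n (fun=> false) (fun j => b <= j <= m)%N b id
           (cyc b q) id psi) //=.
- lia.
- by move=> j lj Jj; rewrite /psi /cyc; do ?case: ifP; lia.
- move=> x y e; case: (eqVneq x y) => [|ne]; [by left|right].
  have H z : (z == q) || (b < z <= m)%N -> exists j,
      [/\ (j < r)%N, (b <= j <= m)%N & z = cyc b q j].
    move=> Jz; exists (if z == q then b else z).
    by rewrite /cyc; split; do ?case: ifP; lia.
  have [Jx Jy]: (x == q) || (b < x <= m)%N /\ (y == q) || (b < y <= m)%N.
    by move: e; rewrite /psi; do ?case: ifP; lia.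
  have [j [? ? ?]] := H _ Jx; have [j' [? ? ?]] := H _ Jy.
  by exists j, j'.
- by move=> j lj; left; exists j.
Qed.

End Generators.

(** * Insertion and deletion in words *)

Definition insw (q x : nat) (w : seq nat) := take q w ++ x :: drop q w.
Definition delw (q : nat) (w : seq nat) := take q w ++ drop q.+1 w.

Lemma size_insw q x w : (q <= size w)%N -> size (insw q x w) = (size w).+1.
Proof. by move=> le; rewrite size_cat /= size_take size_drop; case: ifP; lia. Qed.

Lemma size_delw q w : size (delw q w) = (if q < size w then (size w).-1 else size w)%N.
Proof. by rewrite size_cat /= size_take size_drop; case: ifP; lia. Qed.

Lemma nth_insw x0 q x w i : (q <= size w)%N ->
  nth x0 (insw q x w) i =
    if (i < q)%N then nth x0 w i else if i == q then x else nth x0 w i.-1.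
Proof.
move=> le; rewrite nth_cat size_take_min (minn_idPl le).
case: ltnP => [lt|ge]; first by rewrite nth_take.
case: eqVneq => [->|ne]; first by rewrite subnn.
have ->: (i - q = (i.-1 - q).+1)%N by lia.
by rewrite /= nth_drop; congr nth; lia.
Qed.

Lemma nth_delw x0 q w i :
  nth x0 (delw q w) i = if (i < q)%N then nth x0 w i else nth x0 w i.+1.
Proof.
case: (leqP q (size w)) => le.
  rewrite nth_cat size_take_min (minn_idPl le).
  case: ltnP => [lt|ge]; first by rewrite nth_take.
  by rewrite nth_drop; congr nth; lia.
rewrite /delw take_oversize ?drop_oversize ?cats0; try lia.
by case: ltnP => // ge; rewrite !nth_default; lia.
Qed.

(** * The two halves of a step acting on a state *)

Section States.
Variables (r : nat) (n : int).

(* A state [(g, w)] after [m = size g] steps: [nth g i] is the label of the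
   block of the southern vertex [i], [w] lists the labels of the propagating
   blocks from left to right, the northern vertices [i] with
   [size w <= i < m] are isolated, and [i >= m] is joined to its southern twin. *)
Definition north (m : nat) (w : seq nat) (i : nat) : nat :=
  if (i < size w)%N then nth 0%N w i else if (i < m)%N then (r + i)%N else i.
Definition south (g : seq nat) (i : nat) : nat := nth i g i.
(* In a half step, the block labelled [x] is being moved. *)
Definition nhalf (m x : nat) (w : seq nat) (i : nat) : nat :=
  if (i < size w)%N then nth 0%N w i else if (i <= m)%N then x else i.

Definition stB (s : seq nat * seq nat) : PA r :=
  lbasis r (north (size s.1) s.2) (south s.1).

(** The two alternatives are a block picked at position [q] of the word and a new block named after
    the vertex [m]. In both, the merged positions are the picked block, if any, the isolated
    northern vertices and the vertex [m]. *)
Lemma half_step b q x g w (m := size g)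
    (psi := fun j => if (j == q) || (b < j <= m)%N then q else j) :
  (q <= b <= m)%N -> (m < r)%N -> (size w <= m)%N ->
  (size w = b.+1 /\ x = nth 0%N w q) \/ [/\ size w = b, q = b & x = m] ->
  all (gtn m) g -> all (gtn m) w ->
  pmul n (lbasis r (psi \o cyc b q) psi) (stB (g, w)) =
    lbasis r (nhalf m x (delw q w)) (south (rcons g x)).
Proof.
move=> /andP[qb bm] mr swm Hx gm wm.
have {}gm i : (i < m)%N -> (nth i g i < m)%N by move/(all_nthP i)/(_ i): gm.
have {}wm i : (i < size w)%N -> (nth 0%N w i < m)%N by move/(all_nthP 0%N)/(_ i): wm.
(* Renamed to [x] are the label [m] of the vertex not yet treated and the labels [r + i] of the
   isolated northern vertices. *)
pose mu y := if (y == m) || (r + size w <= y < r + m)%N then x else y.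
have mu_lt y : (y < r)%N -> y != m -> mu y = y by rewrite /mu; case: ifP; lia.
have xm : (x <= m)%N by case: Hx => [[sw ->]|[]]; [have := wm q; lia|lia].
have mux : mu x = x by rewrite /mu; case: ifP.
have muN i : (i < r)%N -> mu (north m w i) = nhalf m x w i.
  move=> li; rewrite /north /nhalf; case: ltnP => [/wm lw|ge].
    by rewrite mu_lt //; lia.
  by rewrite /mu; do ?case: ifP; lia.
have muS i : (i < r)%N -> mu (south g i) = south (rcons g x) i.
  move=> li; rewrite /south nth_rcons -/m; case: ltnP => [lt|ge].
    by rewrite mu_lt ?(set_nth_default i) //; have := gm _ lt; lia.
  rewrite nth_default // /mu; case: eqVneq => //= ne.
  by case: ifP => //; lia.
rewrite /stB (@lbasis_mul_left r n (fun=> false)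
  (fun j => (j == q) || (b < j <= m)%N) q (cyc b q) (north m w) (south g) mu) //=.
- apply: lbasis_ext => i li /=; last by rewrite muS.
  rewrite muN ?cyc_lt //; try lia.
  rewrite /nhalf size_delw nth_delw.
  case: Hx => [[sw ex]|[sw eq ex]].
    rewrite sw /cyc; have [->|ne] := eqVneq i b.
      by rewrite -ex; do ?case: ifP; lia.
    case: (ltnP i q) => iq; first by do ?case: ifP => //; lia.
    have ->: (b < i <= q)%N = false by lia.
    rewrite /=.
    by do ?case: ifP => //; lia.
  by rewrite eq cyc_id sw ltnn; case: ltnP.
- by move=> i li _; rewrite cyc_lt //; lia.
- lia.
- move=> j lj Jj; rewrite !muN //; last lia.
  rewrite /nhalf; case: Hx => [[sw ex]|[sw eq ex]].
    have [->|ne] := eqVneq j q; first by [].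
    by rewrite sw -ex; do ?case: ifP; lia.
  by rewrite sw; do ?case: ifP; lia.
- move=> y z e; case: (eqVneq y z) => [|ne]; [by left|right].
  (* Any label sent to [x] by [mu] is carried by one of the merged positions. *)
  have H u : (u == m) || (r + size w <= u < r + m)%N || (u == x) -> exists j,
      [/\ (j < r)%N, (j == q) || (b < j <= m)%N & u = north m w j].
    move=> Ju; exists (if u == m then m else if (u == x) then q else u - r)%N.
    rewrite /north; have [->|um] := eqVneq u m.
      by case: Hx => [[sw ex]|[sw eq ex]]; split; do ?case: ifP; lia.
    have [ux|ux] := eqVneq u x.
      case: Hx => [[sw ex]|[sw eq ex]]; last lia.
      by split; rewrite ?eqxx //; [lia|case: ifP; lia].
    by case: Hx => [[sw ex]|[sw eq ex]]; split; do ?case: ifP; lia.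
  have [Jy Jz]: (y == m) || (r + size w <= y < r + m)%N || (y == x) /\
                (z == m) || (r + size w <= z < r + m)%N || (z == x).
    by move: e; rewrite /mu; do ?case: ifP; lia.
  have [j [? ? ?]] := H _ Jy; have [j' [? ? ?]] := H _ Jz.
  by exists j, j'.
move=> j lj; left; exists (cyc q b j); rewrite cycK; split => //.
by apply: cyc_lt; lia.
Qed.

(** The map [p] encodes where the moved block is inserted. Cutting off the positions [c..m] creates
    no loop, because [x] and all labels in [w] occur in [g]: each of these blocks contains a
    southern vertex. *)
Lemma full_step c m x g w w' (p : nat -> nat) :
  size g = m.+1 -> (size w <= c <= m.+1)%N -> (m < r)%N ->
  all (gtn m.+1) g -> all (gtn m.+1) w -> {subset w <= g} -> x \in g ->
  (forall i, (i < r)%N -> (p i < r)%N) ->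
  (forall i, (m < i)%N -> p i = i) ->
  size w' = c -> (forall i, (i < c)%N -> nth 0%N w' i = nhalf m x w (p i)) ->
  pmul n (pmul n (eint r n (m.+1 - c) m.+1) (lbasis r p id))
         (lbasis r (nhalf m x w) (south g)) = stB (g, w').
Proof.
move=> sg /andP[wc cm] mr gm wm wg xg p_lt p_id sw' w'E.
have {}gm y : y \in g -> (y <= m)%N by move/(allP gm).
rewrite eint_lbasis ?leq_subr // subKn //.
pose K i := (c <= i <= m)%N.
have -> : pmul n (lbasis r (fun i => if (c <= i < m.+1)%N then r + i else i)%N id)
    (lbasis r p id) = lbasis r (fun i => if K i then r + i else p i)%N id.
  rewrite (@lbasis_mul_left r n K (fun=> false) 0%N id p id id) //=.
  - by move=> y z; left.
  - by move=> i j li lj _; have := p_lt _ lj; lia.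
  - by move=> j lj; right; exists (p j); rewrite ?p_lt.
have hE j : (j < r)%N -> ((m < j)%N /\ nhalf m x w j = j) \/ nhalf m x w j \in g.
  move=> lj; rewrite /nhalf; case: (ltnP j (size w)) => lt; first by
    right; apply: wg; rewrite mem_nth.
  by case: leqP => _; [right|left].
rewrite (@lbasis_mul_left r n K (fun=> false) 0%N p (nhalf m x w) (south g) id) //=.
- rewrite /stB /= sg; apply: lbasis_ext => i li //.
  rewrite /north sw' /K; case: ltnP => [lt|ge]; first by rewrite /= w'E.
  rewrite ltnS; case: leqP => //= lt.
  by rewrite p_id // /nhalf; do ?case: ifP; lia.
- by move=> i li _; apply: p_lt.
- by move=> y z; left.
- move=> i j li lj _; split.
    by case: (hE j lj) => [[_ ->]|/gm]; lia.
  rewrite /south; case: (ltnP j (size g)) => lt; last by rewrite nth_default //; lia.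
  by apply/eqP => e; have := gm _ (mem_nth j lt); rewrite e; lia.
move=> j lj; right; case: (hE j lj) => [[lt ->]|jg].
  by exists j; rewrite // /south nth_default // sg.
have li : (index (nhalf m x w j) g < m.+1)%N by rewrite -sg index_mem.
exists (index (nhalf m x w j) g); first lia.
by rewrite /south nth_index.
Qed.

End States.

(** * Rows of the propagating blocks *)

Local Open Scope nat_scope.

Lemma nth_strip0 s i : nth 0 (strip0 s) i = nth 0 s i.
Proof.
rewrite /strip0 -{3}[s]revK; set u := rev s; set k := find _ u.
rewrite -{2}(cat_take_drop k u) rev_cat nth_cat; case: ltnP => // le.
rewrite nth_default //; set j := i - _; apply/esym.
have [lt|ge] := ltnP j (size (rev (take k u))); last by rewrite nth_default.
rewrite nth_rev; last by rewrite -size_rev.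
rewrite size_rev in lt; set l := _ - _.
have lk : l < k by rewrite /l size_take_min in lt *; lia.
by rewrite nth_take //; apply/eqP/negbFE; rewrite (before_find 0 lk).
Qed.

Lemma prow_addbox la b i : 0 < i -> prow (addbox la b) i = prow la i + (b == i).
Proof.
case: i => // i _; rewrite /prow /addbox /=; case: b => [|b] /=; first by rewrite addn0.
by rewrite nth_incr_nth eqSS addnC.
Qed.

Lemma prow_rmbox la a i : 0 < i -> prow (rmbox la a) i = prow la i - (a == i).
Proof.
case: i => // i _; rewrite /rmbox /prow /=; case: a => [|a] /=; first by rewrite subn0.
by rewrite nth_strip0 nth_set_nth /= eqSS [i == a]eq_sym; case: eqP => [->|]; lia.
Qed.

Lemma count_leqS a (s : seq nat) :
  count (fun y => y <= a.+1) s = count (fun y => y <= a) s + count_mem a.+1 s.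
Proof. by elim: s => //= y s ->; lia. Qed.

Section RowCounts.
Variables (la s : seq nat).
Hypothesis s_gt0 : all (ltn 0) s.
Hypothesis prowE : forall i, 0 < i -> prow la i = count_mem i s.

(** Here [s] carries one row index per box of [la]. The induction adds one row at a time; positivity
    of the entries settles [a = 0]. *)
Lemma ppref_count a : ppref la a = count (fun y => y <= a) s.
Proof.
elim: a => [|a IH].
  rewrite /ppref take0 /=; apply/esym/eqP; rewrite -leqn0 leqNgt -has_count.
  by apply/hasPn => y /(allP s_gt0); rewrite -ltnNge.
have ->: ppref la a.+1 = ppref la a + prow la a.+1.
  rewrite /ppref /prow /=; case: (ltnP a (size la)) => lt.
    by rewrite (take_nth 0) // -cats1 sumn_cat /= addn0.
  by rewrite nth_default // !take_oversize //; lia.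
by rewrite IH prowE // count_leqS.
Qed.

(** No entry of [s] exceeds the length of [la], since the row that it names is nonempty. *)
Lemma psize_count : psize la = size s.
Proof.
have := ppref_count (size la); rewrite /psize /ppref take_size => ->.
apply/eqP; rewrite -all_count; apply/allP => y ys; have y0 := allP s_gt0 _ ys.
have : 0 < prow la y by rewrite prowE // -has_count has_pred1.
by rewrite /prow; case: (ltnP y.-1 (size la)) => [|ge]; [lia|rewrite nth_default].
Qed.

End RowCounts.

Section SortedWords.
Implicit Types (s : seq nat).

Lemma sorted_insw q b s :
  sorted leq (insw q b s) =
    [&& sorted leq s, all (fun y => y <= b) (take q s) & all (leq b) (drop q s)].
Proof.
rewrite -{2}(cat_take_drop q s) !(sorted_pairwise leq_trans) /insw !pairwise_cat /=.
rewrite allrel_consr; move: (take q s) (drop q s) => u v.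
case: (boolP (all _ u)) => /= Hu; last by rewrite !andbF.
case: (boolP (all (leq b) v)) => /= Hv; last by rewrite !andbF.
by rewrite !andbT.
Qed.

(** The entries at most [a] of a sorted word form an initial segment. *)
Lemma sorted_nth_leq a s i : sorted leq s -> i < size s ->
  (nth 0 s i <= a) = (i < count (fun y => y <= a) s).
Proof.
elim: s i => // y s IH i /= ss; case: i => [|i] lt /=.
  case: (leqP y a) => /= lt_ay; rewrite ?add0n //; apply: esym; apply: negbTE.
  rewrite -leqNgt leqn0 eqn0Ngt -has_count; apply/hasPn => z zs.
  by have := allP (order_path_min leq_trans ss) _ zs; lia.
rewrite IH ?(path_sorted ss) //; case: (leqP y a) => // lt_ay.
suff ->: count (fun y => y <= a) s = 0 by [].
apply/eqP; rewrite eqn0Ngt -has_count; apply/hasPn => z zs.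
by have := allP (order_path_min leq_trans ss) _ zs; lia.
Qed.

(* [P] and [p] play the roles of [\gamma]_b and \gamma_b, where [\gamma] is
   the shape obtained after the insertion. *)
Lemma sorted_insw_iff P p q b s : 0 < b -> sorted leq s -> q <= size s ->
  P = (count (fun y => y <= b) s).+1 -> p = (count_mem b s).+1 ->
  sorted leq (insw q b s) = (q < P <= q + p).
Proof.
move=> b0 ss qs -> ->; rewrite sorted_insw ss /=.
have E := count_leqS b.-1 s; rewrite (prednK b0) in E.
have Hb i := @sorted_nth_leq b s i ss; have Hb' i := @sorted_nth_leq b.-1 s i ss.
have cs := count_size (fun y => y <= b.-1) s.
move: E Hb Hb' cs; move: (count_mem b s) (count (leq^~ b) s) (count (leq^~ b.-1) s).
move=> C A B E Hb Hb' cs; congr andb.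
  apply/(all_nthP 0)/idP => [H|H i].
    case: q qs H => [|q] qs H //; have := H q.
    by rewrite size_take_min nth_take // Hb //; lia.
  by rewrite size_take_min => lt; rewrite nth_take ?Hb; lia.
apply/(all_nthP 0)/idP => [H|H i].
  have [lt|ge] := ltnP q (size s); last lia.
  have := H 0; rewrite size_drop nth_drop addn0 => /(_ ltac:(lia)).
  by have := Hb' _ lt; lia.
rewrite size_drop nth_drop => lt.
have lt' : q + i < size s by lia.
by have := Hb' _ lt'; lia.
Qed.

End SortedWords.

Lemma map_insw (h : nat -> nat) q x w : map h (insw q x w) = insw q (h x) (map h w).
Proof. by rewrite /insw map_cat /= map_take map_drop. Qed.

Lemma perm_insw q x w : perm_eq (insw q x w) (x :: w).
Proof. by rewrite /insw -cat_rcons -cats1 -catA perm_catCA /= cat_take_drop. Qed.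

Lemma delw_insw q x w : q <= size w -> delw q (insw q x w) = w.
Proof.
move=> le; rewrite /delw /insw take_size_cat ?size_takel //.
by rewrite -cat_rcons drop_size_cat ?cat_take_drop // size_rcons size_takel.
Qed.

Lemma insw_delw q w : q < size w -> insw q (nth 0 w q) (delw q w) = w.
Proof.
move=> lt; rewrite /delw /insw take_size_cat ?size_takel ?(ltnW lt) //.
by rewrite drop_size_cat ?size_takel ?(ltnW lt) // -drop_nth // cat_take_drop.
Qed.

(** * Rows of the labelled blocks along a path *)

Definition upd (h : nat -> nat) (x b : nat) : nat -> nat :=
  fun y => if y == x then b else h y.

(* [h x] is the row of the block labelled [x] ([0] for blocks that do not
   propagate); the labels [g] record the blocks moved by the successive steps
   of [t], a block created at step [m] being labelled [m]. *)
Fixpoint run (h : nat -> nat) (t : pathT) (g : seq nat) : nat -> nat :=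
  match t, g with
  | (a, b) :: t', x :: g' => run (upd h x b) t' g'
  | _, _ => h
  end.

Fixpoint valid (m : nat) (h : nat -> nat) (t : pathT) (g : seq nat) : bool :=
  match t, g with
  | [::], [::] => true
  | (a, b) :: t', x :: g' =>
      (if a == 0 then x == m else h x == a) && valid m.+1 (upd h x b) t' g'
  | _, _ => false
  end.

Definition h0 : nat -> nat := fun=> 0.

Lemma valid_size m h t g : valid m h t g -> size g = size t.
Proof. by elim: t m h g => [|[a b] t IH] m h [|x g] //= /andP[_ /IH ->]. Qed.

Lemma run_cat h t1 t2 g1 g2 : size g1 = size t1 ->
  run h (t1 ++ t2) (g1 ++ g2) = run (run h t1 g1) t2 g2.
Proof. by elim: t1 h g1 => [|[a b] t1 IH] h [|x g1] //= [/IH ->]. Qed.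

Lemma valid_cat m h t1 t2 g1 g2 : size g1 = size t1 ->
  valid m h (t1 ++ t2) (g1 ++ g2) =
    valid m h t1 g1 && valid (m + size t1) (run h t1 g1) t2 g2.
Proof.
elim: t1 m h g1 => [|[a b] t1 IH] m h [|x g1] //=; first by rewrite addn0.
by move=> [/IH ->]; rewrite addSnnS andbA.
Qed.

Lemma valid_rcons m h t a b g x : size g = size t ->
  valid m h (rcons t (a, b)) (rcons g x) =
    valid m h t g && (if a == 0 then x == m + size t else run h t g x == a).
Proof. by move=> e; rewrite -!cats1 valid_cat //= andbT. Qed.

Lemma run_rcons h t a b g x : size g = size t ->
  run h (rcons t (a, b)) (rcons g x) = upd (run h t g) x b.
Proof. by move=> e; rewrite -!cats1 run_cat. Qed.

Lemma run_notin h t g x : x \notin g -> run h t g x = h x.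
Proof.
elim: t h g => [|[a b] t IH] h [|y g] //=; rewrite inE negb_or => /andP[ne ni].
by rewrite IH // /upd (negPf ne).
Qed.

(** A step removing a box from a positive row moves a block that is already propagating, hence one
    created before; any other step uses its own index as label. *)
Lemma valid_lt m h t g : valid m h t g -> (forall x, m <= x -> h x = 0) ->
  all (gtn (m + size g)) g.
Proof.
elim: t m h g => [|[a b] t IH] m h [|x g] //= /andP[c v] hm.
have xm : x <= m by case: eqVneq c; [lia|case: leqP => // /ltnW /hm ->; lia].
rewrite -addSnnS; apply/andP; split; first lia.
by apply: (IH _ _ _ v) => y ym; rewrite /upd; case: eqP => [|_]; [lia|apply: hm; lia].
Qed.

Lemma valid_lt0 t g : valid 0 h0 t g -> all (gtn (size g)) g.
Proof. by move/valid_lt => /(_ (fun _ _ => erefl)). Qed.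

Lemma run_supp t g x : valid 0 h0 t g -> size g <= x -> run h0 t g x = 0.
Proof.
move=> v le; apply: run_notin; apply/negP => /(allP (valid_lt0 v)) /=.
by rewrite ltnNge le.
Qed.

Lemma run_in t g x : 0 < run h0 t g x -> x \in g.
Proof. by apply: contraTT => /(run_notin h0 t) ->. Qed.

(** These are the row-sorted words in the propagating blocks. The order inside a row is free, which
    accounts for the sums $M_{\gamma,b}$. *)
Definition compat (h : nat -> nat) (w : seq nat) : Prop :=
  [/\ uniq w, forall x, (x \in w) = (0 < h x) & sorted leq (map h w)].

(* The same, with the block labelled [x] taken out. *)
Definition half_compat (h : nat -> nat) (x : nat) (w : seq nat) : Prop :=
  [/\ uniq w, forall y, (y \in w) = (y != x) && (0 < h y) & sorted leq (map h w)].

Lemma count_upd h x b N i : x < N ->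
  count (fun y => upd h x b y == i) (iota 0 N) + (h x == i) =
  count (fun y => h y == i) (iota 0 N) + (b == i).
Proof.
move=> xN; have /perm_to_rem p : x \in iota 0 N by rewrite mem_iota.
rewrite !(permP p) /= {1}/upd eqxx.
rewrite (eq_in_count (a2 := fun y => h y == i)); first by move: (count _ _) => c; lia.
move=> y; rewrite (rem_filter _ (iota_uniq _ _)) mem_filter /= /upd => /andP[/negPf -> //].
Qed.

Lemma pst_rcons t m : pst t m.+1 = if m < size t then
  addbox (rmbox (pst t m) (nstep t m).1) (nstep t m).2 else pst t m.
Proof.
rewrite /pst; case: ltnP => lt; last by rewrite !take_oversize //; lia.
by rewrite (take_nth (0, 0)) // -cats1 foldl_cat.
Qed.

(** A label about to be created is still in row 0, so the two cases of the validity condition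
    agree. *)
Lemma row_of_moved t g x a : valid 0 h0 t g ->
  (if a == 0 then x == size g else run h0 t g x == a) -> run h0 t g x = a.
Proof. by move=> v; case: eqP => [->|_] /eqP // ->; rewrite (run_supp v). Qed.

(** The shape of the path records how many blocks lie in each row. Any bound [N] from [m] on works,
    as later labels are in row 0. *)
Lemma count_rows t m g N i : m <= size t -> valid 0 h0 (take m t) g ->
  m <= N -> 0 < i ->
  count (fun x => run h0 (take m t) g x == i) (iota 0 N) = prow (pst t m) i.
Proof.
elim: m g => [|m IH] g lt.
  rewrite take0; case: g => //= _ _ i0; rewrite /h0 /pst take0 /prow nth_nil.
  by case: i i0 => //= i _; rewrite (eq_count (a2 := pred0)) ?count_pred0.
rewrite (take_nth (0, 0)) // -/(nstep t m); case E: (nstep t m) => [a b].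
move=> v; have := valid_size v; rewrite size_rcons size_takel ?(ltnW lt) //.
case/lastP: g v => // g x + /eqP; rewrite size_rcons eqSS => v /eqP sg.
have sgt : size g = size (take m t) by rewrite size_takel ?(ltnW lt).
move: v; rewrite valid_rcons // run_rcons // => /andP[v c] mN i0.
rewrite -sgt add0n in c; have ha := row_of_moved v c.
rewrite pst_rcons lt E prow_addbox // prow_rmbox //= -(IH g) ?(ltnW lt) ?(ltnW mN) //.
have xN : x < N.
  case: eqP c => [_|a0] /eqP c; first by lia.
  case: (leqP (size g) x) => [/(run_supp v)|]; lia.
have := count_upd (run h0 (take m t) g) b i xN; rewrite ha.
(* The block [x] itself lies in row [a], so the truncated subtraction of a box in that row is
   exact. *)
have : a = i -> 0 < count (fun y => run h0 (take m t) g y == i) (iota 0 N).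
  by move=> e; rewrite -has_count; apply/hasP; exists x; rewrite ?mem_iota // ha e.
move: (count _ _) (count _ _) => c1 c2.
by case: (eqVneq a i) => [e /(_ e)|_ _]; lia.
Qed.

Lemma compat_ext h h' w : h =1 h' -> compat h w -> compat h' w.
Proof.
by move=> e [u m s]; split => // [x|]; rewrite -?e // -(eq_map e).
Qed.

Lemma map_upd_notin h x b w : x \notin w -> map (upd h x b) w = map h w.
Proof.
move=> xw; apply/eq_in_map => y yw; rewrite /upd; case: eqP => // e.
by rewrite -e yw in xw.
Qed.

Lemma half_notin h x w : half_compat h x w -> x \notin w.
Proof. by case=> _ -> _; rewrite eqxx. Qed.

Lemma compat_gt0 (h : nat -> nat) (w : seq nat) :
  (forall y, y \in w -> 0 < h y) -> all (ltn 0) (map h w).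
Proof. by move=> H; apply/allP => _ /mapP[y /H ? ->]. Qed.

Lemma half_gt0 h x w : half_compat h x w -> all (ltn 0) (map h w).
Proof. by case=> _ m _; apply: compat_gt0 => y; rewrite m => /andP[]. Qed.

Lemma compat_half h w x : compat h w -> h x = 0 -> half_compat h x w.
Proof.
move=> [u m s] hx; split=> // y; rewrite m.
by case: eqVneq => // ->; rewrite hx.
Qed.

Section HalfCounts.
Variables (t : pathT) (m : nat) (g w : seq nat) (x : nat).
Let h := run h0 (take m t) g.
Hypothesis m_le : m <= size t.
Hypothesis g_valid : valid 0 h0 (take m t) g.
Hypothesis w_half : half_compat h x w.

Lemma prow_half i : 0 < i -> prow (pst t m) i = count_mem i (map h w) + (h x == i).
Proof.
move=> i0; pose N := maxn m x.+1.
rewrite -(@count_rows t m g N i m_le g_valid (leq_maxl _ _) i0) -/h.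
rewrite count_map -!size_filter; case: w_half => uw mw _.
have sg : size g = m by rewrite (valid_size g_valid) size_takel.
have -> : nat_of_bool (h x == i) = size (nseq (h x == i) x) by rewrite size_nseq.
rewrite -size_cat; apply/perm_size/uniq_perm.
- by rewrite filter_uniq ?iota_uniq.
- rewrite cat_uniq filter_uniq //=; case: eqP => //= _.
  by rewrite orbF andbT mem_filter mw eqxx andbF.
move=> y; rewrite mem_cat mem_nseq !mem_filter mem_iota mw /= add0n.
case: (eqVneq y x) => [->|ne] /=.
  by rewrite andbF lt0b andbT /N leq_max ltnSn orbT andbT.
rewrite andbF orbF; case: eqP => //= e; rewrite e i0 /N.
case: (ltnP y m) => [|le]; first by lia.
by move: e; rewrite /h (run_supp g_valid) ?sg // => e; rewrite -e in i0.
Qed.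

End HalfCounts.

(** With $P=[\gamma]_b$ and $c=\gamma_b$, the entry number [i] comes from the summand number [i] of
    $M_{\gamma,b}$; positions in words start at 0, hence [P.-1]. For [b = 0] the block leaves the
    word. *)
Definition placements (b P c x : nat) (w : seq nat) : seq (seq nat) :=
  if b == 0 then [:: w] else [seq insw (P.-1 - i) x w | i <- iota 0 c].

Section Placements.
Variables (h : nat -> nat) (x b P c : nat) (w : seq nat).
Hypothesis Pc : 0 < b -> P = (count (fun y => y <= b) (map h w)).+1 /\
                         c = (count_mem b (map h w)).+1.

Lemma c_le_P : 0 < b -> c <= P.
Proof.
move=> b0; have [-> ->] := Pc b0; rewrite ltnS; apply: sub_count => y /= /eqP ->.
exact: leqnn.
Qed.

(** Sortedness is [sorted_insw_iff]. The filter shows that the old word can be read off from the new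
    one, which later gives uniqueness of predecessors. *)
Lemma placements_compat w' : half_compat h x w -> w' \in placements b P c x w ->
  compat (upd h x b) w' /\ filter (predC1 x) w' = w.
Proof.
move=> hw; have xw := half_notin hw; case: (hw) => uw mw sw.
have fw v : {subset v <= w} -> filter (predC1 x) v = v.
  move=> sv; apply/all_filterP/allP => y /sv yw /=.
  by apply: contraNneq xw => <-.
rewrite /placements; case: eqP => [->|/eqP].
  rewrite inE => /eqP ->; split; last exact: fw.
  split; rewrite ?map_upd_notin // => y; rewrite mw /upd.
  by case: eqP.
rewrite -lt0n => b0 /mapP[i]; rewrite mem_iota /= add0n => ic ->.
have cP := c_le_P b0; have [eP ec] := Pc b0.
have qw : P.-1 - i <= size w.
  have := count_size (fun y => y <= b) (map h w); rewrite size_map => cs.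
  by apply: leq_trans (leq_subr _ _) _; rewrite eP.
have P0 : 0 < P by rewrite eP.
move qE: (P.-1 - i) qw => q qw.
split; last first.
  rewrite filter_cat /= eqxx !fw ?cat_take_drop // => y; first exact: mem_drop.
  exact: mem_take.
have pq := perm_insw q x w; split.
- by rewrite (perm_uniq pq) /= xw.
- by move=> y; rewrite (perm_mem pq) inE mw /upd; case: eqP.
rewrite map_insw {1}/upd eqxx map_upd_notin //.
by rewrite (sorted_insw_iff b0 sw _ eP ec) ?size_map //; clear eP ec; lia.
Qed.

End Placements.

Lemma split_uniq x (w : seq nat) : uniq w -> x \in w ->
  let w1 := filter (predC1 x) w in
  index x w <= size w1 /\ w = insw (index x w) x w1.
Proof.
move=> + xw; case/splitPr: xw => p1 p2.
rewrite cat_uniq /= negb_or => /and4P[u1 /andP[x1 _] x2 _] /=.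
have f p : x \notin p -> filter (predC1 x) p = p.
  by move=> xp; apply/all_filterP/allP => y yp /=; apply: contraNneq xp => <-.
rewrite filter_cat /= eqxx /= !f // index_cat (negPf x1) /= eqxx addn0.
by rewrite size_cat leq_addr /insw take_size_cat // drop_size_cat.
Qed.

(** Sortedness forces the position of [x] into the range of [sorted_insw_iff], which is exactly the
    range of the summands of $M_{\gamma,b}$. *)
Lemma compat_placements (h : nat -> nat) x b w' (w := filter (predC1 x) w') :
  compat (upd h x b) w' -> half_compat h x w /\
  forall P c, (0 < b -> P = (count (fun y => y <= b) (map h w)).+1 /\
                        c = (count_mem b (map h w)).+1) ->
  w' \in placements b P c x w.
Proof.
move=> [uw' mw' sw'].
have xw : x \notin w by rewrite mem_filter /= eqxx.
have mw y : (y \in w) = (y != x) && (0 < h y).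
  by rewrite mem_filter /= mw' /upd; case: eqP.
have sw : sorted leq (map h w).
  rewrite -(map_upd_notin h b xw).
  apply: (subseq_sorted leq_trans) sw'; exact/map_subseq/filter_subseq.
have hw : half_compat h x w by split => //; apply: filter_uniq.
split=> // P c Pc; rewrite /placements; case: eqP => [b0|/eqP].
  rewrite inE eq_sym; apply/eqP/all_filterP/allP => y /=.
  by rewrite mw' /upd; case: eqP => //; rewrite b0.
rewrite -lt0n => b0; have [eP ec] := Pc b0.
have xw' : x \in w' by rewrite mw' /upd eqxx.
have [qw w'E] := split_uniq uw' xw'; rewrite -/w in qw w'E.
move: sw'; rewrite {1}w'E map_insw {1}/upd eqxx map_upd_notin //.
rewrite (sorted_insw_iff b0 sw _ eP ec) ?size_map // => qP.
apply/mapP; exists (P.-1 - index x w'); first by rewrite mem_iota; lia.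
by rewrite {1}w'E; congr insw; lia.
Qed.

(** * Enumeration of the states of a path *)

Definition state := (seq nat * seq nat)%type.
(** With $p=[\alpha]_a$, position [p.-1] holds the last block of row [a]. For [a = 0] a block named
    after the number of steps done so far is created. *)
Definition moved (a p : nat) (s : state) := if a == 0 then size s.1 else nth 0 s.2 p.-1.
Definition rest (a p : nat) (s : state) := if a == 0 then s.2 else delw p.-1 s.2.

Definition nexts (t : pathT) (m : nat) (s : state) : seq state :=
  let a := (nstep t m).1 in let b := (nstep t m).2 in
  let p := ppref (pst t m) a in let ga := pst t m.+1 in
  let x := moved a p s in
  [seq (rcons s.1 x, w) | w <- placements b (ppref ga b) (prow ga b) x (rest a p s)].

Fixpoint states (t : pathT) (m : nat) : seq state :=
  if m is m'.+1 then flatten [seq nexts t m' s | s <- states t m']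
  else [:: ([::], [::])].

(** This guarantees that each step finds a block to move. *)
Definition removable (t : pathT) : Prop := forall m, m < size t ->
  let a := (nstep t m).1 in a = 0 \/ 0 < prow (pst t m) a.

Section Step.
Variables (t : pathT) (m : nat) (g : seq nat).
Let h := run h0 (take m t) g.
Let a := (nstep t m).1.
Let b := (nstep t m).2.
Let p := ppref (pst t m) a.
Let ga := pst t m.+1.
Hypothesis m_lt : m < size t.
Hypothesis g_valid : valid 0 h0 (take m t) g.

Lemma size_valid_take : size g = m.
Proof. by rewrite (valid_size g_valid) size_takel // ltnW. Qed.

Lemma run_ge x : m <= x -> h x = 0.
Proof. by move=> le; rewrite /h (run_supp g_valid) // size_valid_take. Qed.

Lemma prow_compat w i : compat h w -> 0 < i ->
  prow (pst t m) i = count_mem i (map h w).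
Proof.
move=> /compat_half/(_ (run_ge (leqnn m))) hw i0.
rewrite (prow_half (ltnW m_lt) g_valid hw i0) -/h (run_ge (leqnn m)).
by rewrite eq_sym eqn0Ngt i0 addn0.
Qed.

(** The word has [p] entries in rows at most [a] and strictly fewer in rows below [a], since row [a]
    is nonempty; by sortedness the entry at [p.-1] is in row [a]. *)
Lemma pick_half w (x := moved a p (g, w)) (w1 := rest a p (g, w)) :
  (a = 0 \/ 0 < prow (pst t m) a) -> compat h w ->
  [/\ half_compat h x w1, if a == 0 then x == size g else h x == a &
      (a != 0) ==> [&& 0 < p, p <= size w & w == insw p.-1 x w1]].
Proof.
rewrite {}/x {}/w1 /moved /rest; case: eqP => [-> _ cw|a0 [//|pa] cw].
  by split=> //; apply: compat_half (run_ge _); rewrite ?size_valid_take.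
have := cw; case=> uw mw sw.
have w0 : all (ltn 0) (map h w) by apply: compat_gt0 => y; rewrite mw.
have {}a0 : 0 < a by lia.
have E i : 0 < i -> prow (pst t m) i = count_mem i (map h w) by exact: prow_compat.
have pE : p = count (fun y => y <= a) (map h w) by rewrite /p (ppref_count w0 E).
have pE' := count_leqS a.-1 (map h w); rewrite prednK // -pE -E // in pE'.
have p0 : 0 < p by lia.
have pw : p <= size w by rewrite pE -(size_map h) count_size.
have pw' : p.-1 < size w by lia.
have ins := insw_delw pw'; set x := nth 0 w p.-1 in ins *.
have xa : h x = a.
  have := @sorted_nth_leq a _ p.-1 sw; have := @sorted_nth_leq a.-1 _ p.-1 sw.
  by rewrite size_map (nth_map 0) // -/x -pE; lia.
have pi := perm_insw p.-1 x (delw p.-1 w); rewrite ins in pi.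
have xd : x \notin delw p.-1 w by move: uw; rewrite (perm_uniq pi) => /andP[].
split; last 2 first.
- by rewrite xa eqxx.
- by rewrite p0 pw ins eqxx.
split.
- by move: uw; rewrite (perm_uniq pi) => /andP[].
- move=> y; have := perm_mem pi y; rewrite inE mw => ->.
  by case: eqP => [->|]//=; rewrite (negPf xd).
by move: sw; rewrite -{1}ins map_insw sorted_insw => /and3P[].
Qed.

Section Half.
Variables (x : nat) (w1 : seq nat).
Hypothesis w1_half : half_compat h x w1.
Hypothesis x_row : if a == 0 then x == size g else h x == a.

Let xa : h x = a. Proof. exact: row_of_moved g_valid x_row. Qed.

Lemma prow_phalf i : 0 < i -> prow (phalf t m) i = count_mem i (map h w1).
Proof.
move=> i0; rewrite /phalf prow_rmbox // (prow_half (ltnW m_lt) g_valid w1_half i0).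
by rewrite -/h xa addnK.
Qed.

Lemma prow_next i : 0 < i -> prow ga i = count_mem i (map h w1) + (b == i).
Proof. by move=> i0; rewrite /ga pst_rcons m_lt prow_addbox // prow_phalf. Qed.

Lemma next_counts : 0 < b ->
  ppref ga b = (count (fun y => y <= b) (map h w1)).+1 /\
  prow ga b = (count_mem b (map h w1)).+1.
Proof.
move=> b0; split; last by rewrite prow_next // eqxx addn1.
rewrite (@ppref_count _ (b :: map h w1)) /= ?leqnn //.
  by rewrite b0 (half_gt0 w1_half).
by move=> i i0; rewrite prow_next //= addnC.
Qed.

Lemma psize_phalf : psize (phalf t m) = size w1.
Proof. by rewrite (psize_count (half_gt0 w1_half) prow_phalf) size_map. Qed.

Lemma psize_next : psize ga = size w1 + (0 < b).
Proof.
case: (posnP b) => b0; last first.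
  rewrite (@psize_count _ (b :: map h w1)) /= ?size_map ?addn1 //.
    by rewrite b0 (half_gt0 w1_half).
  by move=> i i0; rewrite prow_next //= addnC.
rewrite (@psize_count _ (map h w1)) ?size_map ?addn0 ?(half_gt0 w1_half) //.
by move=> i i0; rewrite prow_next // b0; case: i i0 => // i; rewrite addn0.
Qed.

(** The inverse of picking: [x] is put back at the end of its row, or just forgotten if it was
    new. *)
Lemma unpick_half : exists w,
  [/\ compat h w, moved a p (g, w) = x & rest a p (g, w) = w1].
Proof.
have := x_row; rewrite /moved /rest /=; case: eqP => [a0 /eqP ->|/eqP + _].
  exists w1; split=> //; case: w1_half => u m1 s; split => // y.
  by rewrite m1; case: eqP => //= ->; rewrite xa a0.
rewrite -lt0n => a0; have w0 := half_gt0 w1_half.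
(* The position following all other blocks in rows at most [a]. *)
pose q := count (fun y => y <= a) (map h w1).
have qw : q <= size w1 by rewrite -(size_map h) count_size.
exists (insw q x w1).
have [|cw _] := @placements_compat h x a q.+1 (count_mem a (map h w1)).+1 w1
   (fun=> conj erefl erefl) (insw q x w1) w1_half.
  by rewrite /placements -[a == 0]negbK -lt0n a0 /= subn0 mem_head.
have pE : p = q.+1.
  rewrite /p (@ppref_count _ (a :: map h w1)) /= ?a0 ?leqnn //.
  move=> i i0; rewrite (prow_half (ltnW m_lt) g_valid w1_half i0) -/h xa.
  by rewrite addnC.
split; last 2 first.
- by rewrite pE nth_insw // ltnn eqxx.
- by rewrite pE delw_insw.
by apply: compat_ext cw => y; rewrite /upd; case: eqP => // ->; rewrite xa.
Qed.

End Half.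
End Step.

(** Induction on the number of steps: picking and placing preserve the two conditions, and
    [compat_placements] with [unpick_half] reconstructs a predecessor. *)
Lemma mem_states t m (g w : seq nat) : removable t -> m <= size t ->
  (g, w) \in states t m <->
  valid 0 h0 (take m t) g /\ compat (run h0 (take m t) g) w.
Proof.
move=> rt; elim: m g w => [|m IH] g w lt.
  rewrite take0 inE; split; first by case/eqP => -> ->.
  case: g => [|x g] [] //= _ [_ mw _]; case: w mw => // y w /(_ y).
  by rewrite mem_head.
rewrite (take_nth (0, 0)) // -/(nstep t m) [nstep t m]surjective_pairing.
have szt : size (take m t) = m by rewrite size_takel // ltnW.
split.
  move=> /flattenP[_ /mapP[[g1 w1] /IH-/(_ (ltnW lt))[v1 c1] ->]].
  case/mapP=> w2 w2P [-> ->]; have sg1 := size_valid_take lt v1.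
  have [hw xr _] := pick_half lt v1 (rt _ lt) c1.
  have xr' := xr; rewrite sg1 in xr'.
  rewrite valid_rcons ?run_rcons ?szt // add0n v1 xr'; split=> //.
  by have [] := placements_compat (next_counts lt v1 hw xr) hw w2P.
case=> v; have := valid_size v; rewrite size_rcons.
case/lastP: g v => // g x + /eqP; rewrite size_rcons eqSS => v /eqP sg.
move: v; rewrite valid_rcons // run_rcons // szt add0n => /andP[v xr].
have em : m = size g by rewrite sg.
rewrite [X in x == X]em in xr.
case/compat_placements=> hw /(_ _ _ (next_counts lt v hw xr)) wP.
have [w1 [cw1 mx rx]] := unpick_half lt v hw xr.
apply/flattenP; exists (nexts t m (g, w1)).
  by apply/mapP; exists (g, w1) => //; apply/IH => //; apply: ltnW.
apply/mapP; exists w; last by rewrite mx.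
by rewrite mx rx.
Qed.

(** The last label is the moved block; deleting it from the word and reinserting it at its old place
    recovers the predecessor. Successors of one state differ in the position of that block. Hence
    the sums below are multiplicity-free. *)
Lemma uniq_states t m : removable t -> m <= size t -> uniq (states t m).
Proof.
move=> rt; elim: m => [//|m IH] lt /=.
have inj s1 s2 s' : s1 \in states t m -> s2 \in states t m ->
    s' \in nexts t m s1 -> s' \in nexts t m s2 -> s1 = s2.
  case: s1 s2 => [g1 w1] [g2 w2] /(mem_states _ _ rt (ltnW lt))[v1 c1].
  move=> /(mem_states _ _ rt (ltnW lt))[v2 c2].
  case/mapP=> w3 p1 -> /mapP[w4 p2] [/rcons_inj[] e1 e2 e3] /=.
  subst g2 w4.
  have [h1 r1 /implyP i1] := pick_half lt v1 (rt _ lt) c1.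
  have [h2 r2 /implyP i2] := pick_half lt v2 (rt _ lt) c2.
  have [_ f1] := placements_compat (next_counts lt v1 h1 r1) h1 p1.
  have [_ f2] := placements_compat (next_counts lt v2 h2 r2) h2 p2.
  congr pair; move: f1 f2; rewrite e2 => -> e; move: i1 i2; rewrite e2 e.
  case: eqP => [a0 _ _|a0 /(_ isT)/and3P[_ _ /eqP E1] /(_ isT)/and3P[_ _ /eqP E2]].
    by move: e; rewrite /rest a0.
  exact: etrans E1 (esym E2).
have un s : s \in states t m -> uniq (nexts t m s).
  case: s => [g w] /(mem_states _ _ rt (ltnW lt))[v c].
  have [hw xr _] := pick_half lt v (rt _ lt) c.
  rewrite map_inj_uniq; last by move=> u u' [].
  rewrite /placements; case: eqP => // /eqP; rewrite -lt0n => b0.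
  rewrite map_inj_in_uniq ?iota_uniq // => i j; rewrite !mem_iota /= !add0n => ic jc.
  have cP := c_le_P (next_counts lt v hw xr) b0.
  have xw := half_notin hw.
  set x := moved _ _ _ in xw *; set z := rest _ _ _ in xw *.
  have ix q : q <= size z -> index x (insw q x z) = q.
    move=> qw; rewrite index_cat /= eqxx addn0 size_takel //.
    by case: ifP => // /mem_take; rewrite (negPf xw).
  have [eP _] := next_counts lt v hw xr b0.
  have qw k : (ppref (pst t m.+1) (nstep t m).2).-1 - k <= size z.
    apply: leq_trans (leq_subr _ _) _; rewrite eP /= -(size_map (run h0 (take m t) g)).
    exact: count_size.
  by move=> /(congr1 (index x)); rewrite !ix //; clear eP; lia.
elim: (states t m) (IH (ltnW lt)) inj un => //= s l IHl /andP[sl ul] inj un.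
rewrite cat_uniq un ?mem_head // IHl //=; last first.
- by move=> s1 ?; apply: un; rewrite inE orbC; apply/orP; left.
- by move=> s1 s2 s' ? ?; apply: inj; rewrite inE orbC; apply/orP; left.
rewrite andbT; apply/hasPn => s' /flattenP[_ /mapP[s1 s1l ->] s's1].
apply: contraNN sl => s's.
by rewrite (inj s s1 s') ?mem_head // inE s1l orbT.
Qed.

(** * [u_t] as a sum over states *)

Local Open Scope ring_scope.

Section PathSum.
Variables (r : nat) (n : int) (t : pathT).
Hypothesis size_t : size t = r.
Hypothesis t_ok : removable t.

(** [half_step] carries out the removal; then each summand of [Mgb] yields one successor by
    [full_step]. *)
Lemma u_step m (g w : seq nat) : (m < r)%N -> (g, w) \in states t m ->
  pmul n (uB r n t m) (pmul n (uA r n t m) (stB r (g, w))) =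
    \sum_(s <- nexts t m (g, w)) stB r s.
Proof.
move=> mr; have lt : (m < size t)%N by rewrite size_t.
case/(mem_states _ _ t_ok (ltnW lt)) => v cw.
have sg := size_valid_take lt v.
have [hw xr /implyP Pw] := pick_half lt v (t_ok lt) cw.
rewrite /nexts /=; set a := (nstep t m).1 in hw xr Pw *.
set b := (nstep t m).2; set p := ppref (pst t m) a in hw xr Pw *.
set x := moved a p (g, w) in hw xr Pw *; set w1 := rest a p (g, w) in hw Pw *.
have sb := psize_phalf lt v hw xr.
have sga := psize_next lt v hw xr; have nc := next_counts lt v hw xr.
have gm : all (gtn m) g by rewrite -sg (valid_lt0 v).
have wg : {subset w <= g}.
  by case: cw => _ mw _ y; rewrite mw; apply: run_in.
have wm : all (gtn m) w by apply/allP => y /wg; apply: (allP gm).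
have sw : (size w <= m)%N.
  case: cw => uw _ _; rewrite -(size_iota 0 m); apply: uniq_leq_size => // y yw.
  by have /= := allP wm _ yw; rewrite mem_iota; lia.
have w1w : {subset w1 <= w}.
  case: hw cw => _ m1 _ [_ m2 _] y; rewrite m1 m2 => /andP[] //.
have xm : (x <= m)%N.
  case: eqP xr => [_ /eqP ->|a0 /eqP xa]; first by rewrite sg.
  by case: (leqP x m) => // /ltnW/(run_ge lt v); lia.
(* The position of the moved block. For [a = 0] it is the first place after the word, which makes
   the cycle trivial, as in the convention $s_{l,0}=1$. *)
pose q := if a == 0%N then size w1 else p.-1.
have Hq : (q <= size w1)%N /\ ((size w = (size w1).+1 /\ x = nth 0%N w q) \/
    [/\ size w = size w1, q = size w1 & x = m]).
  rewrite /q /x /w1 /moved /rest; case: eqP Pw => [a0 _|a0 /(_ isT)/and3P[p0 pw _]].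
    by split=> //; right.
  rewrite size_delw /=; have -> : (p.-1 < size w)%N by lia.
  by split; [lia|left; split=> //; lia].
have w1E : delw q w = w1.
  rewrite /q /w1 /rest; case: eqP => // _.
  by rewrite /delw take_size drop_oversize ?cats0.
have sLKE : sLK r n (psize (pst t m)) p = lbasis r (cyc (size w1) q) id.
  rewrite /q /p; case: eqP Pw => [a0 _|a0 /(_ isT)/and3P[p0 pw _]].
    rewrite a0 /sLK /ppref take0 /= orbT pone_lbasis.
    by apply: lbasis_ext => i _ //; rewrite cyc_id.
  have gt0 : all (ltn 0) (map (run h0 (take m t) g) w).
    by apply: compat_gt0 => y; case: cw => _ ->.
  rewrite (psize_count gt0 (fun i => prow_compat lt v cw)) size_map.
  case: Hq => q1 [[sz _]|[sz qq _]]; last by rewrite /q (introF eqP a0) in q1 qq; lia.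
  rewrite sz -[ppref (pst t m) a]prednK // sLK_lbasis //; lia.
have {}sLKE : pmul n (uA r n t m) (stB r (g, w)) =
    lbasis r (nhalf m x w1) (south (rcons g x)).
  have [q1 Hx] := Hq; have w1m : (size w1 <= m)%N by case: Hx => [[]|[]]; lia.
  rewrite /uA /= sb sLKE ehalf_mul_cyc ?q1 //.
  have := @half_step r n (size w1) q x g w; rewrite sg => -> //; last by rewrite q1.
  by rewrite w1E.
rewrite {}sLKE.
have w1m : (size w1 <= m)%N by case: Hq => _ [[]|[]]; lia.
have srg : size (rcons g x) = m.+1 by rewrite size_rcons sg.
have rgm : all (gtn m.+1) (rcons g x).
  by rewrite all_rcons /= ltnS xm; apply: sub_all gm => y /= /leqW.
have w1m' : all (gtn m.+1) w1.
  by apply/allP => y /w1w/(allP wm) /= /leqW.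
have w1g : {subset w1 <= rcons g x}.
  by move=> y /w1w/wg yg; rewrite mem_rcons inE yg orbT.
have xg : x \in rcons g x by rewrite mem_rcons mem_head.
rewrite big_map /placements /uB /= -/b /Mgb; case: (posnP b) => b0.
  (* For [b = 0] both $M_{\gamma,0}$ and $s_{0,|\gamma|}$ are 1, so the rearrangement is the
     identity. *)
  rewrite b0 /= big_seq1 /sLK /ppref take0 /= pone_lbasis lbasis_mul_perm //; last first.
    by move=> j lj; exists j.
  apply: full_step => //; rewrite sga -/b b0 /= addn0 ?leqnn ?(leqW w1m) //.
  by move=> i iw; rewrite /nhalf iw.
have [eP ec] := nc b0; have cP := c_le_P nc b0.
rewrite big_map pmul_suml pmul_sumr pmul_suml /index_iota subn0.
rewrite -[in RHS]/b -/b in eP ec cP *.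
set P := ppref _ b in eP cP *; set c := prow _ b in ec cP *.
have P0 : (0 < P)%N by rewrite eP.
have Pw1 : (P <= (size w1).+1)%N.
  by rewrite eP ltnS -(size_map (run h0 (take m t) g)) count_size.
rewrite sga -/b b0 addn1; apply: eq_big_seq => i; rewrite mem_iota add0n /= => ic.
clear eP ec.
have sLKP l k : (0 < l <= r)%N -> (0 < k <= r)%N ->
    sLK r n l k = lbasis r (cyc l.-1 k.-1) id.
  by case: l k => [|l] [|k] //= ? ?; rewrite sLK_lbasis.
have [Pi1 [Pi2 [P1 [sw1 Pw2]]]] : (0 < P - i <= r)%N /\ (P - i).-1 = (P.-1 - i)%N /\
    (0 < P <= r)%N /\ (0 < (size w1).+1 <= r)%N /\ (P.-1 <= size w1)%N.
  by clear - ic cP P0 Pw1 w1m mr; lia.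
rewrite !sLKP // Pi2; set q' := (P.-1 - i)%N.
have q'P : (q' <= P.-1)%N := leq_subr _ _.
have wr : (size w1 < r)%N by [].
have Pr : (P.-1 < r)%N := leq_ltn_trans Pw2 wr.
have q'r : (q' < r)%N := leq_ltn_trans q'P Pr.
have q'w : (q' <= size w1)%N := leq_trans q'P Pw2.
(* The summand of $M_{\gamma,b}$ and $s_{[\gamma]_b,|\gamma|}$ combine into a single cycle, which
   brings the moved block from the end to position [q']. *)
rewrite lbasis_mul_cyc // (_ : lbasis r _ id = lbasis r (cyc q' (size w1)) id); last first.
  by apply: lbasis_ext => // k _; rewrite /= cyc_comp // q'P.
apply: full_step => //.
- by rewrite leqnSn ltnS.
- by move=> k; apply: cyc_lt.
- by move=> k lk; rewrite cyc_gt // q'w (leq_ltn_trans w1m).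
- by rewrite size_insw.
move=> k; rewrite ltnS => lk; rewrite nth_insw // /nhalf cyc_le //.
case: (ltngtP k q') => [lt1|gt1|_]; last by rewrite ltnn w1m.
  by rewrite (leq_trans lt1 q'w).
by rewrite (leq_trans _ lk) // prednK // (leq_ltn_trans _ gt1).
Qed.

Lemma u_path_states : u_path r n t = \sum_(s <- states t r) stB r s.
Proof.
rewrite /u_path size_t.
suff H m : (m <= size t)%N ->
    pprod n (flatten [seq [:: uB r n t k; uA r n t k] | k <- rev (iota 0 m)]) =
    \sum_(s <- states t m) stB r s by rewrite H ?size_t.
elim: m => [|m IH] lt.
  rewrite /= big_seq1 pone_lbasis /stB; apply: lbasis_ext => i _ //=.
  by rewrite /south nth_nil.
rewrite -[in LHS]addn1 iotaD rev_cat /= IH ?(ltnW lt) // !pmul_sumr.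
rewrite big_flatten big_map /=; apply: eq_big_seq => -[g w] gw.
by rewrite u_step // -size_t.
Qed.
End PathSum.

(** * Interchanging two consecutive steps *)

Lemma upd_ext h h' x b : h =1 h' -> upd h x b =1 upd h' x b.
Proof. by move=> e y; rewrite /upd e. Qed.

Lemma run_ext h h' t g : h =1 h' -> run h t g =1 run h' t g.
Proof.
by elim: t h h' g => [|[a b] t IH] h h' [|x g] //= e; apply/IH/upd_ext.
Qed.

Lemma valid_ext m h h' t g : h =1 h' -> valid m h t g = valid m h' t g.
Proof.
elim: t m h h' g => [|[a b] t IH] m h h' [|x g] //= e.
by rewrite e (IH _ _ _ _ (upd_ext x b e)).
Qed.

Section Relabel.
Variable p : nat -> nat.
Hypothesis pK : involutive p.

Lemma upd_relabel h x b : upd (h \o p) (p x) b =1 upd h x b \o p.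
Proof. by move=> y; rewrite /upd /= (can2_eq pK pK). Qed.

Lemma run_relabel h t g : run (h \o p) t (map p g) =1 run h t g \o p.
Proof.
elim: t h g => [|[a b] t IH] h [|x g] //= y.
by rewrite (run_ext _ _ (upd_relabel h x b)) IH.
Qed.

(** Blocks created from step [m] on have prescribed labels, so the renaming has to fix these. *)
Lemma valid_relabel m h t g : (forall x, (m <= x)%N -> p x = x) ->
  valid m (h \o p) t (map p g) = valid m h t g.
Proof.
elim: t m h g => [|[a b] t IH] m h [|x g] //= pm.
rewrite (valid_ext _ _ _ (upd_relabel h x b)) IH ?pK; last by move=> y /ltnW/pm.
by rewrite -{1}(pm m (leqnn m)) (can_eq pK).
Qed.

Lemma compat_relabel h w : compat h w -> compat (h \o p) (map p w).
Proof.
case=> u m s; split.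
- by rewrite map_inj_uniq //; apply: inv_inj.
- by move=> y; rewrite -{1}(pK y) mem_map ?m //; apply: inv_inj.
by rewrite -map_comp (eq_map (g := h)) // => y /=; rewrite pK.
Qed.

End Relabel.

Definition admissible (t : pathT) (s : state) : Prop :=
  valid 0 h0 t s.1 /\ compat (run h0 t s.1) s.2.

Lemma mem_statesP t s : removable t ->
  s \in states t (size t) <-> admissible t s.
Proof.
by move=> rt; case: s => g w; rewrite (mem_states _ _ rt (leqnn _)) take_size.
Qed.

Section Swap.
Variable k : nat.
Let p := cyc k k.+1.

Lemma cyc_invol : involutive p.
Proof. by move=> i; rewrite /p /cyc; do ?case: ifP; lia. Qed.

Lemma cyc_id_lt i : (i < k)%N -> p i = i.
Proof. by rewrite /p /cyc; do ?case: ifP; lia. Qed.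

Lemma cyc_id_gt i : (k.+2 <= i)%N -> p i = i.
Proof. by rewrite /p /cyc; do ?case: ifP; lia. Qed.

Lemma cyc_l : p k = k.+1. Proof. by rewrite /p /cyc eqxx. Qed.
Lemma cyc_r : p k.+1 = k. Proof. by rewrite -cyc_l cyc_invol. Qed.

Definition swp (g : seq nat) : seq nat :=
  take k g ++ nth 0 g k.+1 :: nth 0 g k :: drop k.+2 g.

Lemma split2 (T : Type) (x0 : T) (g : seq T) : (k.+1 < size g)%N ->
  exists g1 x1 x2 g2, g = g1 ++ x1 :: x2 :: g2 /\ size g1 = k.
Proof.
move=> lt; exists (take k g), (nth x0 g k), (nth x0 g k.+1), (drop k.+2 g).
by rewrite -!drop_nth ?cat_take_drop ?size_takel //; lia.
Qed.

Section Cat.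
Variables (g1 g2 : seq nat) (x1 x2 : nat).
Hypothesis sg1 : size g1 = k.

Lemma nth_cat_k : nth 0 (g1 ++ x1 :: x2 :: g2) k = x1.
Proof. by rewrite nth_cat sg1 ltnn subnn. Qed.

Lemma nth_cat_k1 : nth 0 (g1 ++ x1 :: x2 :: g2) k.+1 = x2.
Proof. by rewrite nth_cat sg1 ltnNge leqnSn subSn // subnn. Qed.

Lemma swp_cat : swp (g1 ++ x1 :: x2 :: g2) = g1 ++ x2 :: x1 :: g2.
Proof.
rewrite /swp nth_cat_k nth_cat_k1 take_size_cat //.
by rewrite drop_cat sg1 ltnNge -addn2 leq_addr addKn /= drop0.
Qed.

End Cat.

Lemma size_swp g : (k.+1 < size g)%N -> size (swp g) = size g.
Proof.
move=> /(split2 0%N)[g1 [x1 [x2 [g2 [-> sg1]]]]].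
by rewrite swp_cat // !size_cat.
Qed.

Lemma nth_swp g i x0 : (k.+1 < size g)%N -> (i < size g)%N ->
  nth x0 (swp g) i = nth x0 g (p i).
Proof.
move=> /(split2 0%N)[g1 [x1 [x2 [g2 [-> sg1]]]]] _.
rewrite swp_cat // !nth_cat sg1.
case: (ltngtP i k) => [lt|gt|->]; first by rewrite cyc_id_lt // lt.
  have [->|ne] := eqVneq i k.+1; first by rewrite cyc_r ltnn subnn subSn // subnn.
  rewrite cyc_id_gt ?ltnNge ?(ltnW gt) /=; last lia.
  by have [j ->] : exists j, (i - k = j.+2)%N by exists (i - k).-2; lia.
by rewrite cyc_l ltnNge leqnSn /= subnn subSn // subnn.
Qed.

(** Blocks are named after the step creating them, so interchanging two steps also requires
    exchanging the names [k] and [k+1]. *)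
Definition swst (s : state) : state := (map p (swp s.1), map p s.2).

Lemma swp_map g : (k.+1 < size g)%N -> swp (map p g) = map p (swp g).
Proof.
move=> /(split2 0%N)[g1 [x1 [x2 [g2 [-> sg1]]]]].
by rewrite swp_cat // !map_cat /= swp_cat ?size_map.
Qed.

Lemma swstK s : (k.+1 < size s.1)%N -> swst (swst s) = s.
Proof.
case: s => g w /= lt; rewrite /swst /= swp_map ?size_swp //.
rewrite !(mapK cyc_invol); congr pair.
have [g1 [x1 [x2 [g2 [-> sg1]]]]] := split2 0%N lt.
by rewrite !swp_cat.
Qed.

(** Renaming by [p] is injective and fixes the labels [r + i] of isolated vertices, so it does not
    affect the diagram. *)
Lemma stB_swst r s : size s.1 = r -> (k.+1 < r)%N ->
  stB r (swst s) = stB r (swp s.1, s.2).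
Proof.
case: s => g w /= sg kr; have ksg : (k.+1 < size g)%N by rewrite sg.
rewrite /stB /= size_map size_swp // sg.
apply: (lbasis_inj (e := p)); first exact: inv_inj cyc_invol.
  move=> i li; rewrite /north size_map; case: ltnP => [lt|ge].
    by rewrite (nth_map 0%N).
  by rewrite li cyc_id_gt //; lia.
by move=> i li; rewrite /south -(nth_map _ i) ?size_swp ?sg //;
   apply: set_nth_default; rewrite size_map size_swp ?sg.
Qed.

Lemma stB_mul_sgen r n s : size s.1 = r -> (k.+1 < r)%N ->
  pmul n (stB r s) (sgen r k.+1) = stB r (swp s.1, s.2).
Proof.
case: s => g w /= sg kr; have ksg : (k.+1 < size g)%N by rewrite sg.
rewrite sgen_lbasis /stB lbasis_mul_sgen; first last.
- by move=> i li; apply: cyc_lt => //; lia.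
- exact: cyc_invol.
rewrite /= size_swp //; apply: lbasis_ext => // i li.
rewrite /south /= nth_swp ?sg //; apply: set_nth_default.
by rewrite sg cyc_lt //; lia.
Qed.

Definition same (s : state) : bool := nth 0%N s.1 k == nth 0%N s.1 k.+1.

Lemma same_swst s : (k.+1 < size s.1)%N -> same (swst s) = same s.
Proof.
case: s => g w /= /(split2 0%N)[g1 [x1 [x2 [g2 [-> sg1]]]]].
rewrite /same /= swp_cat // map_cat /= !nth_cat_k ?nth_cat_k1 ?size_map //.
by rewrite (inj_eq (inv_inj cyc_invol)) eq_sym.
Qed.

Lemma swp_same s : (k.+1 < size s.1)%N -> same s -> (swp s.1, s.2) = s.
Proof.
case: s => g w /= /(split2 0%N)[g1 [x1 [x2 [g2 [-> sg1]]]]].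
by rewrite /same /= nth_cat_k // nth_cat_k1 // => /eqP ->; rewrite swp_cat.
Qed.

Section Paths.
Variables (t1 t2 : pathT).
Hypothesis st1 : size t1 = k.

Lemma admissible_split (s1 s2 : step) g1 x1 x2 g2 w (h := run h0 t1 g1)
    (h' := upd (upd h x1 s1.2) x2 s2.2) : size g1 = k ->
  admissible (t1 ++ s1 :: s2 :: t2) (g1 ++ x1 :: x2 :: g2, w) <->
  [/\ valid 0 h0 t1 g1, if s1.1 == 0%N then x1 == k else h x1 == s1.1,
      if s2.1 == 0%N then x2 == k.+1 else upd h x1 s1.2 x2 == s2.1,
      valid k.+2 h' t2 g2 & compat (run h' t2 g2) w].
Proof.
move=> sg1; case: s1 s2 @h' => [a1 b1] [a2 b2] h'.
rewrite /admissible /= valid_cat ?run_cat ?sg1 //= st1 add0n.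
split; first by case=> /and4P[].
by case=> -> -> -> -> c; split.
Qed.

(** Since the two blocks differ, their row updates commute and the second block is already in its
    row before the first step. After renaming, all later steps see the same rows. *)
Lemma swst_admissible (s1 s2 : step) s : ~~ same s ->
  admissible (t1 ++ s1 :: s2 :: t2) s ->
  admissible (t1 ++ s2 :: s1 :: t2) (swst s).
Proof.
case: s => g w ns ad; have sg := valid_size ad.1; rewrite /= in sg.
have /(split2 0%N)[g1 [x1 [x2 [g2 [gE sg1]]]]] : (k.+1 < size g)%N.
  by rewrite sg size_cat /= st1; lia.
move: ns ad; rewrite gE /same /swst /= swp_cat // nth_cat_k // nth_cat_k1 // => ne.
rewrite map_cat /= => /admissible_split-/(_ sg1)[v1 c1 c2 v2 cw].
have g1E : map p g1 = g1.
  apply: map_id_in => y /(allP (valid_lt0 v1)) /=; rewrite sg1; exact: cyc_id_lt.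
have hk y : (k <= y)%N -> run h0 t1 g1 y = 0%N.
  by move=> le; rewrite (run_supp v1) // sg1.
rewrite g1E; apply/admissible_split => //.
set h := run h0 t1 g1 in c1 c2 v2 cw hk *.
(* Before step [k] the labels [k] and [k+1] are both in row 0. *)
have hp : h \o p =1 h.
  move=> y /=; case: (ltnP y k) => [/cyc_id_lt -> //|le].
  by rewrite !hk // /p /cyc; do ?case: ifP; lia.
have E : upd (upd h (p x2) s2.2) (p x1) s1.2 =1
         upd (upd h x1 s1.2) x2 s2.2 \o p.
  move=> y; rewrite /= /upd (can2_eq cyc_invol cyc_invol) (can2_eq cyc_invol cyc_invol).
  have -> : h (p y) = h y := hp y.
  case: (eqVneq y (p x1)) => [->|_] //.
  by rewrite (inj_eq (inv_inj cyc_invol)) (negPf ne).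
have px y a : a != 0%N -> h y == a -> h (p y) == a.
  by move=> _; rewrite -[h (p y)]/((h \o p) y) hp.
split=> //.
- case: eqP c2 => [_ /eqP ->|/eqP a0]; first by rewrite cyc_r.
  by rewrite /upd [x2 == x1]eq_sym (negPf ne); apply: px.
- case: eqP c1 => [_ /eqP ->|/eqP a0]; first by rewrite cyc_l.
  by rewrite /upd (inj_eq (inv_inj cyc_invol)) (negPf ne); apply: px.
- by rewrite (valid_ext _ _ _ E) (valid_relabel cyc_invol) //; apply: cyc_id_gt.
apply: compat_ext (compat_relabel cyc_invol cw) => y /=.
by rewrite (run_ext _ _ E) (run_relabel cyc_invol).
Qed.

(** [swst] matches the two index sets, being its own inverse, and [stB_swst] matches the terms. *)
Lemma sum_not_same r (s1 s2 : step) (t := t1 ++ s1 :: s2 :: t2)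
    (t' := t1 ++ s2 :: s1 :: t2) : size t = r -> removable t -> removable t' ->
  \sum_(s <- states t r | ~~ same s) stB r (swp s.1, s.2) =
  \sum_(s <- states t' r | ~~ same s) stB r s.
Proof.
move=> st rt rt'; have st' : size t' = r by rewrite -st !size_cat.
have kr : (k.+1 < r)%N by rewrite -st size_cat /= st1; lia.
rewrite -big_filter -[RHS]big_filter.
have szs s : s \in states t r -> size s.1 = r.
  by rewrite -{1}st => /(mem_statesP _ rt)[/valid_size -> _].
have szs' s : s \in states t' r -> size s.1 = r.
  by rewrite -{1}st' => /(mem_statesP _ rt')[/valid_size -> _].
transitivity (\sum_(s <- map swst [seq s <- states t r | ~~ same s]) stB r s).
  rewrite big_map; apply: eq_big_seq => s; rewrite mem_filter => /andP[_ /szs e].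
  by rewrite stB_swst.
apply/perm_big/uniq_perm.
- rewrite map_inj_in_uniq ?filter_uniq ?uniq_states ?st //.
  move=> x y; rewrite !mem_filter => /andP[_ /szs ex] /andP[_ /szs ey].
  by move=> /(congr1 swst); rewrite !swstK ?ex ?ey.
- by rewrite filter_uniq ?uniq_states ?st'.
move=> s; apply/mapP/idP => [[s'']|].
  rewrite !mem_filter => /andP[ns is''] ->; rewrite same_swst ?szs // ns /=.
  rewrite -{1}st'; apply/mem_statesP => //; apply: swst_admissible => //.
  by apply/mem_statesP; rewrite ?st.
rewrite mem_filter => /andP[ns is']; have e := szs' _ is'.
exists (swst s); last by rewrite swstK ?e.
rewrite mem_filter same_swst ?e // ns /= -{1}st; apply/mem_statesP => //.
by apply: swst_admissible => //; apply/mem_statesP; rewrite ?st'.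
Qed.

End Paths.
End Swap.

(** * Two consecutive moves of the same block *)

Section Same.
Variables (k : nat) (t1 t2 : pathT) (a1 b1 a2 b2 : nat).
Hypothesis st1 : size t1 = k.
Let t := t1 ++ (a1, b1) :: (a2, b2) :: t2.
Let L := (plen (phalf t k)).+1.
Let te := t1 ++ (a1, L) :: (L, b2) :: t2.
Hypothesis t_ok : removable t.

Lemma nstep_k : nstep t k = (a1, b1).
Proof. by rewrite /nstep nth_cat st1 ltnn subnn. Qed.

Lemma nstep_k1 : nstep t k.+1 = (a2, b2).
Proof. by rewrite /nstep nth_cat st1 ltnNge leqnSn subSn // subnn. Qed.

Lemma pst_te m : (m <= k)%N -> pst te m = pst t m.
Proof. by move=> mk; rewrite /pst !takel_cat ?st1. Qed.

Lemma prow_L : prow (phalf t k) L = 0%N.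
Proof. by rewrite /prow nth_default. Qed.

Lemma k1_lt : (k.+1 < size t)%N.
Proof. by rewrite size_cat /= st1; lia. Qed.

Lemma size_te : size te = size t.
Proof. by rewrite !size_cat. Qed.

Section Reduced.
Hypothesis b1a2 : b1 = a2.
Hypothesis a2_gt0 : (0 < a2)%N.

Lemma nstep_te_k : nstep te k = (a1, L).
Proof. by rewrite /nstep nth_cat st1 ltnn subnn. Qed.

Lemma nstep_te_k1 : nstep te k.+1 = (L, b2).
Proof. by rewrite /nstep nth_cat st1 ltnNge leqnSn subSn // subnn. Qed.

Lemma prow_te_k1 i : (0 < i)%N ->
  prow (pst te k.+1) i = (prow (phalf t k) i + (L == i))%N.
Proof.
move=> i0; rewrite pst_rcons size_te (ltnW k1_lt) prow_addbox // nstep_te_k /=.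
by rewrite pst_te // /phalf nstep_k.
Qed.

Lemma nstep_te m : m != k -> m != k.+1 -> nstep te m = nstep t m.
Proof.
move=> m1 m2; rewrite /nstep !nth_cat st1; case: ltnP => // le.
by have [j ->] : exists j, (m - k = j.+2)%N by exists (m - k).-2; lia.
Qed.

(** In both paths the box added at step [k] is removed at step [k+1], so the shapes agree from then
    on. *)
Lemma prow_te m i : (k.+2 <= m)%N -> (0 < i)%N ->
  prow (pst te m) i = prow (pst t m) i.
Proof.
move=> km; have [j ->] : exists j, (m = k.+2 + j)%N by exists (m - k.+2)%N; lia.
elim: j i => [|j IH] i i0.
  rewrite addn0 [in LHS]pst_rcons size_te k1_lt prow_addbox // nstep_te_k1 /=.
  rewrite prow_rmbox // prow_te_k1 // addnK.
  rewrite pst_rcons k1_lt prow_addbox // nstep_k1 prow_rmbox //=.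
  by rewrite pst_rcons (ltnW k1_lt) prow_addbox // nstep_k /= b1a2 addnK /phalf nstep_k.
rewrite addnS [in LHS]pst_rcons [in RHS]pst_rcons size_te; case: ifP => _; last exact: IH.
by rewrite !prow_addbox // !prow_rmbox // nstep_te ?IH //; lia.
Qed.

Lemma removable_te : removable te.
Proof.
move=> m; rewrite size_te => lt /=; case: (ltngtP m k) => [mk|mk|->].
- by rewrite nstep_te ?pst_te ?(ltnW mk) //; [apply: t_ok|lia|lia].
- have [->|ne] := eqVneq m k.+1.
    by right; rewrite nstep_te_k1 /= prow_te_k1 // eqxx addn1.
  rewrite nstep_te //; last lia.
  case: (t_ok lt) => /= [|H]; first by left.
  case: (posnP (nstep t m).1) => [|a0]; first by left.
  by right; rewrite prow_te //; lia.
by rewrite nstep_te_k pst_te // -[a1]/((a1, b1).1) -nstep_k; apply/t_ok/ltnW/k1_lt.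
Qed.

(** Row [L] is empty after the removal in step [k], so the block put there is alone and is the only
    one that step [k+1] can move. The intermediate row is then overwritten. *)
Lemma admissible_te s : admissible te s <-> admissible t s /\ same k s.
Proof.
case: s => g w.
suff H g1 x1 x2 g2 : g = g1 ++ x1 :: x2 :: g2 -> size g1 = k ->
    admissible te (g, w) <-> admissible t (g, w) /\ same k (g, w).
  split=> [ad|[ad sm]].
    have : (k.+1 < size g)%N by rewrite (valid_size ad.1) size_te k1_lt.
    by case/(split2 0%N) => g1 [x1 [x2 [g2 [/H {}H /H /iffLR]]]]; apply.
  have : (k.+1 < size g)%N by rewrite (valid_size ad.1) k1_lt.
  by case/(split2 0%N) => g1 [x1 [x2 [g2 [/H {}H /H /iffRL]]]]; apply.
move=> -> sg1; rewrite /same /= nth_cat_k // nth_cat_k1 //.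
have := admissible_split t2 st1 (a1, b1) (a2, b2) x1 x2 g2 w sg1.
have := admissible_split t2 st1 (a1, L) (L, b2) x1 x2 g2 w sg1.
rewrite -/t -/te /= => Se St; set h := run h0 t1 g1.
have E : upd (upd h x1 L) x1 b2 =1 upd (upd h x1 b1) x1 b2.
  by move=> y; rewrite /upd; case: eqP.
have a20 : (a2 == 0)%N = false by lia.
rewrite a20 in St; split.
  case/Se => v1 c1 /eqP c2 v2 cw.
  suff e : x1 = x2.
    subst x2; split=> //; apply/St; split=> //; first by rewrite /upd eqxx b1a2.
      by rewrite -(valid_ext _ _ _ E).
    by apply: compat_ext cw; apply: run_ext.
  apply/eqP/negbNE/negP => ne; move: c2; rewrite /upd eq_sym (negPf ne) => hL.
  have xlt y : h y = L -> (y < k)%N.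
    by case: (ltnP y k) => // le; rewrite /h (run_supp v1) // sg1.
  have tk : take k t = t1 by rewrite take_size_cat.
  have xa : h x1 = a1 by apply: row_of_moved v1 _; rewrite sg1.
  have := @count_rows t k g1 k L (ltnW (ltnW k1_lt)); rewrite tk -/h => /(_ v1 (leqnn k) isT).
  have := prow_L; rewrite /phalf prow_rmbox // nstep_k /= => e0 ec.
  (* If [x2] differs from [x1], it was in row [L] before step [k]. Together with [x1], when
     [a1 = L], this gives more blocks than that row can have, as it is empty once [x1] is taken
     out. *)
  have : (size (if a1 == L then [:: x1; x2] else [:: x2]) <=
          size [seq y <- iota 0 k | h y == L])%N.
    apply: uniq_leq_size; first by case: ifP => //=; rewrite inE ne.
    move=> y; rewrite mem_filter mem_iota add0n /= => yi.
    have hy : h y = L.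
      move: yi; case: eqP => [e|_]; rewrite !inE; [case/orP|];
        by move/eqP ->; rewrite ?xa ?(eqP hL).
    by rewrite hy eqxx xlt.
  by rewrite size_filter ec; case: eqP e0 => /=; lia.
case=> /St[v1 c1 c2 v2 cw] /eqP e; subst x2; apply/Se; split=> //.
- by rewrite /upd eqxx.
- by rewrite (valid_ext _ _ _ E).
by apply: compat_ext cw; apply: run_ext => y; rewrite E.
Qed.

End Reduced.

(** A block created at step [k+1] cannot have been moved at step [k]; hence [a2] is positive and is
    the row where step [k] left the block. *)
Lemma same_reduced s : admissible t s -> same k s -> (b1 == a2) && (0 < a2)%N.
Proof.
case: s => g w ad; have : (k.+1 < size g)%N by rewrite (valid_size ad.1); exact: k1_lt.
case/(split2 0%N) => g1 [x1 [x2 [g2 [/= gE sg1]]]]; move: ad; rewrite gE.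
move=> /(admissible_split _ st1 _ _ _ _ _ _ sg1)[/= v1 c1 c2 _ _].
rewrite /same /= nth_cat_k // nth_cat_k1 // => /eqP e; subst x2.
case: (posnP a2) c2 => [a0|a0]; last first.
  by rewrite /upd eqxx andbT.
move=> /eqP e; move: c1; rewrite e.
case: eqP => [_ /eqP|/eqP a10]; first by lia.
by rewrite (run_supp v1) ?sg1 // eq_sym (negPf a10).
Qed.

Lemma sum_same r : size t = r ->
  \sum_(s <- states t r | same k s) stB r s =
  if (b1 == a2) && (0 < a2)%N then \sum_(s <- states te r) stB r s else 0.
Proof.
move=> st; case: ifP => [/andP[/eqP e a0]|nred]; last first.
  rewrite big_seq_cond big1 // => s /andP[]; rewrite -{1}st.
  by move=> /(mem_statesP _ t_ok)/same_reduced H /H; rewrite nred.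
have ste : size te = r by rewrite -st size_te.
have te_ok := removable_te e a0.
rewrite -big_filter; apply/perm_big/uniq_perm.
- by rewrite filter_uniq ?uniq_states ?st.
- by rewrite uniq_states ?ste.
move=> s; rewrite mem_filter -{1}st -{1}ste; apply/andP/idP => [[sm]|].
  move/(mem_statesP _ t_ok) => ad; apply/mem_statesP => //.
  by apply/admissible_te.
move/(mem_statesP _ te_ok)/(admissible_te e a0) => [ad sm]; split=> //.
exact/mem_statesP.
Qed.

End Same.

(** * Assembling the identity *)

Lemma Std_removable r nu t : Std r nu t -> removable t.
Proof.
case/and3P=> /eqP st /allP H _ m lt /=.
have := H m; rewrite mem_iota -st lt => /(_ isT)/andP[+ _].
by rewrite /rm_ok => /orP[/eqP|/andP[]]; [left|right].
Qed.

Lemma set_nth_cat (T : Type) (x0 : T) s1 x s2 y :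
  set_nth x0 (s1 ++ x :: s2) (size s1) y = s1 ++ y :: s2.
Proof. by elim: s1 => //= z s1 ->. Qed.

Theorem theorem3p3 (r : nat) (n : int) (nu : seq nat) (k : nat) (t : pathT) :
  (2 <= r)%N -> is_part nu -> (psize nu <= r)%N ->
  (1 <= k <= r - 1)%N ->
  Std r nu t ->
  Std r nu (pswap t k) ->
  pmul n (u_path r n t) (sgen r k) =
    u_path r n (pswap t k) + u_ek r n t k - u_ek r n (pswap t k) k.
Proof.
(* From here on [k] is the index, counted from 0, of the first of the two interchanged steps. *)
move=> r2 _ _; case: k => // k /andP[_ kr] sT sT'.
have st : size t = r by case/and3P: sT => /eqP.
have := Std_removable sT; have := Std_removable sT'; move: st {sT sT'}.
have [lt|] := ltnP k.+1 (size t); last by lia.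
have [t1 [s1 [s2 [t2 [-> st1]]]]] := split2 (0, 0)%N lt.
have set2 (x y x' y' : step) : set_nth (0, 0)%N
    (set_nth (0, 0)%N (t1 ++ x :: y :: t2) k x') k.+1 y' = t1 ++ x' :: y' :: t2.
  by rewrite -st1 set_nth_cat -cat_rcons -(size_rcons t1 x') set_nth_cat cat_rcons.
have nk (x y : step) : nstep (t1 ++ x :: y :: t2) k = x.
  by rewrite /nstep nth_cat st1 ltnn subnn.
have nk1 (x y : step) : nstep (t1 ++ x :: y :: t2) k.+1 = y.
  by rewrite /nstep nth_cat st1 ltnNge leqnSn subSn // subnn.
rewrite /u_ek /ek /ek_def /pswap -[k.+1.-1]/k !(nk, nk1, set2).
set t' := t1 ++ s2 :: s1 :: t2; set t0 := t1 ++ s1 :: s2 :: t2 => st ok' ok.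
have st' : size t' = r by rewrite -st !size_cat.
have kr1 : (k.+1 < r)%N by lia.
have EK x : size x = r -> removable x -> u_path r n x = \sum_(s <- states x r) stB r s.
  exact: u_path_states.
(* Arbitrary steps [x] and [y] allow the use for the given path and for the interchanged one. *)
have red (x y : step) (u := t1 ++ x :: y :: t2) :
    size u = r -> removable u ->
    \sum_(s <- states u r | same k s) stB r s =
    if (x.2 == y.1) && (0 < y.1)%N then
      u_path r n (t1 ++ (x.1, (plen (phalf u k)).+1) :: ((plen (phalf u k)).+1, y.2) :: t2)
    else 0.
  case: x y @u => [a1 b1] [a2 b2] u su ok_u; rewrite (sum_same st1 ok_u su) /=.
  case: ifP => // /andP[/eqP e a0]; rewrite EK //; first by rewrite -su !size_cat.
  exact: removable_te.
rewrite (EK _ st ok) (EK _ st' ok') pmul_suml.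
have szs s : s \in states t0 r -> size s.1 = r.
  by rewrite -{1}st => /(mem_statesP _ ok)[/valid_size -> _].
have -> : \sum_(s <- states t0 r) pmul n (stB r s) (sgen r k.+1) =
          \sum_(s <- states t0 r) stB r (swp k s.1, s.2).
  by apply: eq_big_seq => s /szs e; rewrite stB_mul_sgen.
(* Terms moving different blocks correspond under the interchange. Those moving the same block give
   $u_{\mathsf e_k(\mathsf t)}$ on the left, and on the right exactly the subtracted term. *)
rewrite (bigID (same k)) /= [in RHS](bigID (same k)) /= (red _ _ st' ok').
rewrite (sum_not_same st1 st ok ok') -(red _ _ st ok).
have -> : \sum_(s <- states t0 r | same k s) stB r (swp k s.1, s.2) =
          \sum_(s <- states t0 r | same k s) stB r s.
  rewrite big_seq_cond [RHS]big_seq_cond; apply: eq_bigr => s /andP[/szs e sm].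
  by rewrite swp_same ?e.
by rewrite [RHS]addrAC [X in _ = X + _]addrAC subrr add0r addrC.
Qed.
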